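(* Assume that $\beta_N(\mu)>0$ and $\tau_N(\mu)\le 1$ for all $\mu\in\mathcal D$. Then, for every $\mu\in\mathcal D$, there exists a unique solution $U_h(\mu)\in X_h$ of the finite element Smagorinsky problem $$A(U_h(\mu),V_h;\mu)=F(V_h;\mu)\qquad\forall V_h\in X_h$$ such that the error with respect to the reduced basis solution $U_N(\mu)$ satisfies $$\|U_h(\mu)-U_N(\mu)\|_X\le\Delta_N(\mu),$$ and, for this solution, the following effectivity bound holds: $$\Delta_N(\mu)\le\left[\frac{2\gamma_N(\mu)}{\beta_N(\mu)}+\tau_N(\mu)\right]\|U_h(\mu)-U_N(\mu)\|_X .$$
   Context: **Domain and mesh.** $\Omega\subset\mathbb R^d$ ($d=2,3$) is a bounded polyhedral domain with boundary $\Gamma=\Gamma_D\cup\Gamma_N$, $\Gamma_D=\Gamma_{D_g}\cup\Gamma_{D_0}$. $\mathcal T_h$ is a conforming, affine-equivalent triangulation of $\overline\Omega$ (triangles/quadrilaterals or tetrahedra/hexahedra), $h_K$ is the diameter of $K\in\mathcal T_h$, $h=\max_K h_K$, and $\chi_K$ is the indicator function of $K$. The parameter $\mu$ (the Reynolds number, $\mu>0$) ranges in a compact interval $\mathcal D\subset\mathbb R$. **Data and eddy viscosity.** $\mathbf f\in(L^2(\Omega))^d$; $\mathbf g_D$ is the Dirichlet datum on $\Gamma_{D_g}$; $\mathbf u_D\in(H^1(\Omega))^d$ is a lift with $\mathbf u_D=\mathbf g_D$ on $\Gamma_{D_g}$, $\mathbf u_D=0$ on $\Gamma_{D_0}$,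 $\nabla\cdot\mathbf u_D=0$ in $\Omega$. With $C_S$ the (positive) Smagorinsky constant and $|\cdot|$ the Frobenius norm on $\mathbb R^{d\times d}$, $\nu_T(\mathbf w)=C_S^2\sum_{K\in\mathcal T_h}h_K^2|\nabla\mathbf w|_K|\,\chi_K$. **Spaces and norms.** $Y=\{\mathbf v\in (H^1(\Omega))^d:\mathbf v|_{\Gamma_D}=0\}$, $M=L^2(\Omega)$, $X=Y\times M$; $Y_h\subset Y$, $M_h\subset M$ are finite-dimensional finite element subspaces on $\mathcal T_h$, and $X_h=Y_h\times M_h$. $\|\cdot\|_{0,2,\Omega}$ is the $L^2(\Omega)$ norm. On $Y$ one uses the inner product $$(\mathbf u,\mathbf v)_T=\int_\Omega\Big[\tfrac1{\overline\mu}+\nu_T^*\Big]\nabla\mathbf u:\nabla\mathbf v\,d\Omega,\qquad \|\cdot\|_T=(\cdot,\cdot)_T^{1/2},$$ where $\nu_T^*=\nu_T(\mathbf w(\overline\mu))$, $\overline\mu=\arg\min_{\mu\in\mathcal D}\{\sum_{K}(C_Sh_K)^2\min_{x\in K}|\nabla\mathbf w(\mu)|(x)\chi_K(x)\}$, and $\mathbf w(\mu)$ is the velocity solution of $\mathbf w\cdot\nabla\mathbf w+\nabla p-\nabla\cdot((\frac1\mu+\nu_T(\mathbf w))\nabla\mathbf w)=\mathbf f$, $\nabla\cdot\mathbf w=0$ in $\Omega$, $\mathbf w=\mathbf g_D$ on $\Gamma_{D_g}$, $\mathbf w=0$ on $\Gamma_{D_0}$, $-p\mathbf n+(\frac1\mu+\nu_T(\mathbf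 w))\partial\mathbf w/\partial\mathbf n=0$ on $\Gamma_N$. The norm $\|\cdot\|_T$ is equivalent to the $H^1$ norm on $Y$. For $U=(\mathbf u,p_u)\in X$, $\|U\|_X=\sqrt{\|\mathbf u\|_T^2+\|p_u\|_{0,2,\Omega}^2}$, with corresponding inner product $(\cdot,\cdot)_X$. $X'_h$ is the dual of $X_h$ and $\|\cdot\|_{X'}$ the dual norm: $\|L\|_{X'}=\sup_{0\ne V_h\in X_h}L(V_h)/\|V_h\|_X$. **Operator.** For $U=(\mathbf u,p_u)$, $V=(\mathbf v,p_v)$, $Z=(\mathbf z,p_z)$: $A(U,V;\mu)=\frac1\mu A_0(U,V)+A_1(U,V)+A_2(U;V)+A_3(U;V)$, with $A_0(U,V)=\int_\Omega\nabla\mathbf u:\nabla\mathbf v$, $A_1(U,V)=\int_\Omega[(\nabla\cdot\mathbf u)p_v-(\nabla\cdot\mathbf v)p_u]+\int_\Omega(\mathbf u_D\cdot\nabla\mathbf u)\mathbf v+\int_\Omega(\mathbf u\cdot\nabla\mathbf u_D)\mathbf v$, $A_2(U;V)=\int_\Omega(\mathbf u\cdot\nabla\mathbf u)\mathbf v$, $A_3(U;V)=\int_\Omega\nu_T(\mathbf u+\mathbf u_D)\nabla(\mathbf u+\mathbf u_D):\nabla\mathbf v$. Also $F(V;\mu)=\int_\Omega\mathbf f\cdot\mathbf v-\frac1\mu\int_\Omega\nabla\mathbf u_D:\nabla\mathbf v-\int_\Omega(\mathbf u_D\cdot\nabla\mathbf u_D)\mathbf v$. The directional derivative of $A(\cdot,V;\mu)$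 at $U$ in direction $Z$ is $$\partial_1A(U,V;\mu)(Z)=\tfrac1\mu A_0(Z,V)+A_1(Z,V)+\int_\Omega(\mathbf u\cdot\nabla\mathbf z)\mathbf v+\int_\Omega(\mathbf z\cdot\nabla\mathbf u)\mathbf v+\int_\Omega\nu_T(\mathbf u+\mathbf u_D)\nabla\mathbf z:\nabla\mathbf v+\sum_{K}\int_K(C_Sh_K)^2\frac{\nabla(\mathbf u+\mathbf u_D):\nabla\mathbf z}{|\nabla(\mathbf u+\mathbf u_D)|}\big(\nabla(\mathbf u+\mathbf u_D):\nabla\mathbf v\big),$$ the last integrand being $0$ where $\nabla(\mathbf u+\mathbf u_D)=0$. **Lipschitz constant.** $\rho_T>0$ is a constant such that for all $U_h^1,U_h^2,Z_h,V_h\in X_h$ and $\mu\in\mathcal D$, $|\partial_1A(U_h^1,V_h;\mu)(Z_h)-\partial_1A(U_h^2,V_h;\mu)(Z_h)|\le\rho_T\|U_h^1-U_h^2\|_X\|Z_h\|_X\|V_h\|_X$. **Reduced basis problem.** For parameter values $\mu^1,\dots,\mu^N\in\mathcal D$ selected by a greedy algorithm, with finite element solutions (snapshots) $(\mathbf u_h(\mu^k),p_h(\mu^k))$, let $M_N=\mathrm{span}\{p_h(\mu^k)\}_{k=1}^N$, $Y_N=\mathrm{span}\{\mathbf u_h(\mu^k),T_p^\mu p_h(\mu^k)\}_{k=1}^N$, $X_N=Y_N\times M_N\subset X_h$, where $T_p^\mu:M_h\to Y_h$ is defined by $(T_p^\mu q_h,\mathbf v_h)_T=-\int_\Omega(\nabla\cdot\mathbf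 v_h)q_h\,d\Omega$ for all $\mathbf v_h\in Y_h$. $U_N(\mu)\in X_N$ is the solution of $A(U_N(\mu),V_N;\mu)=F(V_N;\mu)$ for all $V_N\in X_N$. **Constants and estimator.** $$\beta_N(\mu)=\inf_{Z_h\in X_h}\sup_{V_h\in X_h}\frac{\partial_1A(U_N(\mu),V_h;\mu)(Z_h)}{\|Z_h\|_X\|V_h\|_X},\qquad \gamma_N(\mu)=\sup_{Z_h\in X_h}\sup_{V_h\in X_h}\frac{\partial_1A(U_N(\mu),V_h;\mu)(Z_h)}{\|Z_h\|_X\|V_h\|_X}$$ (over nonzero elements). The residual $\mathcal R(Z_h;\mu)\in X_h'$ is $\langle\mathcal R(Z_h;\mu),V_h\rangle=A(Z_h,V_h;\mu)-F(V_h;\mu)$. Set $$\epsilon_N(\mu)=\|\mathcal R(U_N(\mu);\mu)\|_{X'},\qquad \tau_N(\mu)=\frac{4\epsilon_N(\mu)\rho_T}{\beta_N^2(\mu)},\qquad \Delta_N(\mu)=\frac{\beta_N(\mu)}{2\rho_T}\Big[1-\sqrt{1-\tau_N(\mu)}\Big].$$ *)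

(* Defs.v *)
From HB Require Import structures.
From mathcomp Require Import all_boot all_order all_algebra.
From mathcomp Require Import all_classical all_reals all_analysis.
From mathcomp Require Import measurable_realfun ess_sup_inf.
From mathcomp Require mpoly.
Set Implicit Arguments.
Unset Strict Implicit.
Unset Printing Implicit Defensive.
Import Order.TTheory GRing.Theory Num.Theory.
Import numFieldNormedType.Exports.
Local Open Scope classical_set_scope.
Local Open Scope ring_scope.

(* Borel sigma-algebra of R^n (points are row vectors). *)
HB.instance Definition _ (R : realType) (n : nat) :=
  Measurable.copy 'rV[R]_n (g_sigma_algebraType (@open 'rV[R]_n)).

Definition cons_rV (R : realType) n (p : 'rV[R]_n * R) : 'rV[R]_n.+1 :=
  \row_i if unlift ord0 i is Some j then p.1 0 j else p.2.

Lemma open_rV_bigcup (R : realType) n (A : set 'rV[R]_n) : open A ->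
  A = \bigcup_(q in [set q : 'rV[rat]_n * nat |
        ball (map_mx ratr q.1 : 'rV[R]_n) (q.2.+1%:R^-1) `<=` A])
      ball (map_mx ratr q.1 : 'rV[R]_n) (q.2.+1%:R^-1).
Proof.
move=> oA; apply/seteqP; split => [x Ax|x [q]]; last by apply.
have /nbhs_ballP[e /= e0 xA] : nbhs x A by exact: open_nbhs_nbhs.
have [k ke] : exists k : nat, k.+1%:R^-1 < e / 2.
  have /ltr_add_invr[k] : (0 : R) < e / 2 by rewrite divr_gt0.
  by rewrite add0r; exists k.
have k0 : (0 : R) < k.+1%:R^-1 by rewrite invr_gt0.
have q_ i : {q : rat | `|ratr q - x 0 i| < k.+1%:R^-1}.
  apply/cid; have /rat_in_itvoo[q] : x 0 i - k.+1%:R^-1 < x 0 i + k.+1%:R^-1.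
    by rewrite ltrBlDr -addrA ltrDl addr_gt0.
  by rewrite in_itv/= => qi; exists q; rewrite ltr_distl.
exists (\row_i sval (q_ i), k) => /=.
  move=> y [_ qy]; apply: xA; split => // i j; rewrite ord1 /ball /=.
  have := qy 0 j; rewrite /ball /= !mxE.
  have := svalP (q_ j); set q := ratr _ => xq yq.
  rewrite (_ : x 0 j - y 0 j = - (q - x 0 j) + (q - y 0 j)); last first.
    by rewrite opprB addrA subrK.
  rewrite (le_lt_trans (ler_normD _ _))// normrN (splitr e) ltrD//.
    exact: lt_trans ke.
  exact: lt_trans ke.
by split => // i j; rewrite ord1 /ball /= !mxE; exact: (svalP (q_ j)).
Qed.

Lemma measurable_cons_rV (R : realType) n :
  measurable_fun setT (@cons_rV R n).
Proof.
apply: (measurability (@open 'rV[R]_n.+1)) => //.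
move=> _ [B oB <-]; rewrite setTI (open_rV_bigcup oB) preimage_bigcup bigcup_mkcond.
apply: countable_bigcupT_measurable => //= q; case: ifPn => // _.
have : (0 : R) < q.2.+1%:R^-1 by rewrite invr_gt0.
set r := _^-1 => rpos; set c := map_mx _ _.
rewrite (_ : _ @^-1` _ =
  ball (\row_j c 0 (lift ord0 j)) r `*` ball (c 0 ord0) r).
  apply: measurableX; last by apply: open_measurable; exact: ball_open.
  by apply: sub_sigma_algebra; exact: ball_open.
apply/seteqP; split => [[x y] [r0 xy]|[x y] [[r0 xr] yr]] /=.
  split; first split => //= i j.
    by have := xy 0 (lift ord0 j); rewrite !mxE liftK ord1.
  by have := xy 0 ord0; rewrite !mxE unlift_none.
split => // i j; rewrite ord1 [cons_rV _ 0 j]mxE.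
by case: unliftP => [k ->|->]//=; have := xr 0 k; rewrite mxE.
Qed.

Definition lebesgue_cons (R : realType) n
    (m : {measure set 'rV[R]_n -> \bar R}) :=
  pushforward (m \x lebesgue_measure)%E (@cons_rV R n).
HB.instance Definition _ (R : realType) n
    (m : {measure set 'rV[R]_n -> \bar R}) :=
  Measure.copy (lebesgue_cons m)
    (measure_function_pushforward__canonical__measure_function_Measure
      (m \x lebesgue_measure)%E (@measurable_cons_rV R n)).

(* [lebesgue_rV R n] is the n-dimensional Lebesgue measure on the Borel sets
   of R^n, built as the n-fold product of [lebesgue_measure]. *)
Fixpoint lebesgue_rV (R : realType) n : {measure set 'rV[R]_n -> \bar R} :=
  if n is n'.+1 then lebesgue_cons (lebesgue_rV R n') else \d_(0 : 'rV[R]_0).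

Lemma measurable_coord (R : realType) n (i : 'I_n) (B : set R) :
  measurable B -> measurable [set x : 'rV[R]_n | B (x 0 i)].
Proof.
move=> mB; rewrite -[X in measurable X]setTI.
suff : measurable_fun setT (fun x : 'rV[R]_n => x 0 i).
  by move=> /(_ measurableT _ mB).
apply: (measurability _ (RGenOpens.measurableE R)).
move=> _ [_ [a [b ->]] <-]; rewrite setTI; apply: sub_sigma_algebra.
have /continuousP := @coord_continuous R 1 n 0 i; apply.
exact: interval_open.
Qed.

Lemma lebesgue_rV_box (R : realType) n (B : 'I_n -> set R) :
  (forall i, measurable (B i)) ->
  (lebesgue_rV R n [set x | forall i, B i (x ord0 i)] =
   \prod_(i < n) lebesgue_measure (B i))%E.
Proof.
elim: n B => [|n IH] B mB.
  rewrite big_ord0 /= diracE mem_set//= => -[] //.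
rewrite big_ord_recl /= /lebesgue_cons /pushforward.
rewrite (_ : _ @^-1` _ =
  [set x : 'rV[R]_n | forall i, B (lift ord0 i) (x ord0 i)] `*` B ord0);
  last first.
  apply/seteqP; split => [[x y] /= H|[x y] [/= H0 H1] i].
    split => [i|]; first by have := H (lift ord0 i); rewrite mxE liftK.
    by have := H ord0; rewrite mxE unlift_none.
  by rewrite mxE; case: unliftP => [j ->|->].
rewrite product_measure1E; last exact: mB.
  by rewrite muleC; congr (_ * _)%E; exact: (IH (fun i => B (lift ord0 i))).
rewrite (_ : [set x : 'rV[R]_n | forall i, B (lift ord0 i) (x ord0 i)] =
  \bigcap_(i in [set: 'I_n])
    [set x : 'rV[R]_n | B (lift ord0 i) (x 0 i)]).
  by apply: fin_bigcap_measurable => // i _; exact: measurable_coord.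
by apply/seteqP; split => x H i => [_|]; exact: H.
Qed.

Section euclidean.
Context (R : realType) (d : nat).
Implicit Types (x y u v : 'rV[R]_d) (A B : 'M[R]_d).

Definition dot u v : R := \sum_i u 0 i * v 0 i.

Definition enorm u : R := Num.sqrt (dot u u).

Definition eball x (r : R) : set 'rV[R]_d := [set y | enorm (y - x) < r].

Definition diameter (K : set 'rV[R]_d) : R :=
  sup [set enorm (p.1 - p.2) | p in K `*` K].

Definition ddot A B : R := \sum_i \sum_j A i j * B i j.

Definition fnorm A : R := Num.sqrt (ddot A A).

Definition polytope n (p : 'I_n -> 'rV[R]_d) : set 'rV[R]_d :=
  [set x | exists t : 'I_n -> R,
    [/\ forall k, 0 <= t k, \sum_k t k = 1 & x = \sum_k t k *: p k]].

(* Empty set and [K] itself included. *)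
Definition is_face (F K : set 'rV[R]_d) :=
  exists (a : 'rV[R]_d) (c : R),
    (forall x, K x -> dot a x <= c) /\ F = K `&` [set x | dot a x = c].

(* Regularity (last clause) excludes slits: the domain lies locally on one
   side of each of its boundary facets. *)
Definition polyhedral_domain (Om : set 'rV[R]_d) :=
  [/\ open Om, connected Om, Om !=set0 & bounded_set Om] /\
  (exists (m : nat) (n : 'I_m -> nat) (p : forall k, 'I_(n k) -> 'rV[R]_d),
    closure Om = \bigcup_k polytope (p k)) /\
  interior (closure Om) = Om.

Definition boundary (Om : set 'rV[R]_d) := closure Om `\` Om.

End euclidean.

Section mesh.
Context (R : realType) (d : nat).

(* A cell is the image of a reference cell (unit cube if [cell_cube], unit
   simplex otherwise) under the affine map x |-> x *m cell_mx + cell_org. *)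
Record cell := Cell {
  cell_cube : bool;
  cell_mx : 'M[R]_d;
  cell_org : 'rV[R]_d }.

Definition reference_cell (cube : bool) : set 'rV[R]_d :=
  if cube then [set x | forall i, 0 <= x 0 i <= 1]
  else [set x | (forall i, 0 <= x 0 i) /\ \sum_i x 0 i <= 1].

Definition cell_set (K : cell) : set 'rV[R]_d :=
  [set x *m cell_mx K + cell_org K | x in reference_cell (cell_cube K)].

Definition conforming_mesh (Om : set 'rV[R]_d) n (T : 'I_n -> cell) :=
  [/\ forall k, cell_mx (T k) \in unitmx,
      closure Om = \bigcup_k cell_set (T k),
      forall k l, cell_set (T k) = cell_set (T l) -> k = l &
      forall k l, is_face (cell_set (T k) `&` cell_set (T l)) (cell_set (T k))].

End mesh.

Section sobolev.
Context (R : realType) (d : nat).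
Local Notation leb := (lebesgue_rV R d).
Implicit Types Om S : set 'rV[R]_d.

Definition L2 Om (f : 'rV[R]_d -> R) :=
  measurable_fun Om f /\ leb.-integrable Om (EFin \o (fun x => f x ^+ 2)).

Definition partial (i : 'I_d) (f : 'rV[R]_d -> R) : 'rV[R]_d -> R :=
  fun x => 'D_(delta_mx 0 i) f x.

Fixpoint Ck (k : nat) (f : 'rV[R]_d -> R) : Prop :=
  continuous f /\
  if k is k'.+1 then
    forall i, (forall x, derivable f x (delta_mx 0 i)) /\ Ck k' (partial i f)
  else True.

Definition test_function Om (phi : 'rV[R]_d -> R) :=
  (forall k, Ck k phi) /\
  exists C : set 'rV[R]_d,
    [/\ compact C, C `<=` Om & forall x, ~ C x -> phi x = 0].

(* A vector field is carried together with its (weak) gradient, so that linear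
   combinations and a.e. statements act on both.  Convention:
   [(grad u x) i j] is the i-th partial derivative of the j-th component, so
   that (u . nabla) z is [fld u x *m grad z x] and div u is [\tr (grad u x)]. *)
Definition vfield := (('rV[R]_d -> 'rV[R]_d) * ('rV[R]_d -> 'M[R]_d))%type.

Definition fld (u : vfield) := u.1.
Definition grad (u : vfield) := u.2.

Definition div (u : vfield) (x : 'rV[R]_d) : R := \tr (grad u x).

Definition advect (u z v : vfield) (x : 'rV[R]_d) : R :=
  dot (fld u x *m grad z x) (fld v x).

Definition inH1 Om (u : vfield) :=
  [/\ forall j, L2 Om (fun x => fld u x 0 j),
      forall i j, L2 Om (fun x => grad u x i j) &
      forall phi, test_function Om phi -> forall i j,
        \int[leb]_(x in Om) (fld u x 0 j * partial i phi x) =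
        - \int[leb]_(x in Om) (grad u x i j * phi x)].

Definition normH1 Om (u : vfield) : R :=
  Num.sqrt (\int[leb]_(x in Om) (dot (fld u x) (fld u x)) +
            \int[leb]_(x in Om) (ddot (grad u x) (grad u x))).

(* Negligible for the s-dimensional Hausdorff measure. *)
Definition hausdorff_null (s : nat) (N : set 'rV[R]_d) :=
  forall eps : R, 0 < eps ->
    exists (c : nat -> 'rV[R]_d) (r : nat -> R),
      [/\ forall k, 0 <= r k, N `<=` \bigcup_k eball (c k) (r k) &
          (\sum_(k <oo) (r k ^+ s)%:E <= eps%:E)%E].

(* [g] is the trace on [S] of the Sobolev field [u]: at almost every point of
   [S] for the (d-1)-dimensional Hausdorff measure, g x is the limit in mean
   of [u] over Om `&` eball x r as r tends to 0. *)
Definition has_trace Om S (u g : 'rV[R]_d -> 'rV[R]_d) :=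
  exists2 N, hausdorff_null d.-1 N &
    forall x, S x -> ~ N x ->
      (fine (leb (Om `&` eball x r)))^-1 *
        \int[leb]_(y in Om `&` eball x r) (enorm (u y - g x))
      @[r --> (0 : R)^'+] --> (0 : R).

Definition state := (vfield * ('rV[R]_d -> R))%type.

(* Equality as elements of H^1(Om)^d x L^2(Om). *)
Definition ae_eq_state Om (U V : state) :=
  {ae leb, forall x, Om x ->
    [/\ fld U.1 x = fld V.1 x, grad U.1 x = grad V.1 x & U.2 x = V.2 x]}.

End sobolev.

Section spaces.
Context (R : realType).

Definition span (V : lmodType R) (I : finType) (b : I -> V) : set V :=
  [set v | exists c : I -> R, v = \sum_i c i *: b i].

Definition fin_dim (V : lmodType R) (S : set V) :=
  exists (n : nat) (b : 'I_n -> V), S = span b.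

End spaces.

Record problem (R : realType) (d : nat) := Problem {
  Omega : set 'rV[R]_d;
  GammaDg : set 'rV[R]_d;
  GammaD0 : set 'rV[R]_d;
  GammaN : set 'rV[R]_d;
  ncell : nat;
  mesh : 'I_ncell -> cell R d;
  CS : R;
  force : 'rV[R]_d -> 'rV[R]_d;
  gD : 'rV[R]_d -> 'rV[R]_d;
  uD : vfield R d }.

Arguments mesh {R d} pb k : rename.

Section smagorinsky.
Context (R : realType) (d : nat) (pb : problem R d).
Local Notation leb := (lebesgue_rV R d).
Local Notation Om := (Omega pb).
Local Notation vfield := (vfield R d).
Local Notation state := (state R d).

Definition GammaD := GammaDg pb `|` GammaD0 pb.

Definition K_ (k : 'I_(ncell pb)) : set 'rV[R]_d := cell_set (mesh pb k).

Definition h_ k : R := diameter (K_ k).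

(* Fields are only meaningful on the open set [Omega pb]: integrals and a.e.
   conditions over a closed cell are taken on its trace on [Omega pb], which
   differs from it by a null set. *)
Definition KO k := K_ k `&` Om.

Definition nuT (w : vfield) (x : 'rV[R]_d) : R :=
  CS pb ^+ 2 * \sum_k h_ k ^+ 2 * fnorm (grad w x) * \1_(K_ k) x.

Definition inY (v : vfield) := inH1 Om v /\ has_trace Om GammaD (fld v) (fun=> 0).

Definition divergence_free (u : vfield) :=
  {ae leb, forall x, Om x -> div u x = 0}.

Definition dirichlet_divfree (u : vfield) :=
  [/\ inH1 Om u, has_trace Om (GammaDg pb) (fld u) (gD pb),
      has_trace Om (GammaD0 pb) (fld u) (fun=> 0) & divergence_free u].

Definition classical_grad (phi : 'rV[R]_d -> 'rV[R]_d) : vfield :=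
  (phi, fun x => \matrix_(i, j) partial i (fun y => phi y 0 j) x).

(* Velocity of a weak solution of the Smagorinsky equations at Reynolds number
   [mu].  The momentum equation is tested against C^1 fields vanishing on
   [GammaD], for which every term is integrable; this is the equation in the
   sense of distributions together with the natural condition on [GammaN]. *)
Definition velocity_solution (mu : R) (w : vfield) :=
  dirichlet_divfree w /\
  exists2 p, L2 Om p &
    forall phi : 'rV[R]_d -> 'rV[R]_d, (forall j, Ck 1 (fun x => phi x 0 j)) ->
      (forall x, GammaD x -> phi x = 0) ->
      let v := classical_grad phi in
      \int[leb]_(x in Om) (advect w w v x)
      - \int[leb]_(x in Om) (p x * div v x)
      + \int[leb]_(x in Om)
          ((mu^-1 + nuT w x) * ddot (grad w x) (grad v x))
      = \int[leb]_(x in Om) (dot (force pb x) (phi x)).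

(* The minimum over a cell of the (merely square-integrable) |grad w| is an
   essential infimum; on the cell its indicator factor equals 1. *)
Definition min_viscosity (w : vfield) : \bar R :=
  (\sum_k ((CS pb * h_ k) ^+ 2)%:E *
     ess_inf leb (fun x => if x \in KO k then (fnorm (grad w x))%:E else +oo))%E.

Definition is_argmin (D : set R) (w : R -> vfield) (mubar : R) :=
  D mubar /\
  forall mu, D mu -> (min_viscosity (w mubar) <= min_viscosity (w mu))%E.

(* Finite element functions: polynomial on each cell (the elements being
   affine-equivalent), with the corresponding piecewise gradient. *)
Definition fe_velocity (v : vfield) :=
  forall k, exists P : 'I_d -> mpoly.mpoly d R,
    {ae leb, forall x, KO k x ->
      (forall j, fld v x 0 j = mpoly.meval (x 0) (P j)) /\
      (forall i j, grad v x i j = mpoly.meval (x 0) (mpoly.mderiv i (P j)))}.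

Definition fe_pressure (q : 'rV[R]_d -> R) :=
  forall k, exists P : mpoly.mpoly d R,
    {ae leb, forall x, KO k x -> q x = mpoly.meval (x 0) P}.

Definition fe_velocity_space (Yh : set vfield) :=
  fin_dim Yh /\ forall v, Yh v -> inY v /\ fe_velocity v.

Definition fe_pressure_space (Mh : set ('rV[R]_d -> R)) :=
  fin_dim Mh /\ forall q, Mh q -> L2 Om q /\ fe_pressure q.

(* Inner product and norms attached to a weight [kap] (playing the role of
   1 / mubar + nu_T^* ). *)
Definition ipT (kap : 'rV[R]_d -> R) (u v : vfield) : R :=
  \int[leb]_(x in Om) (kap x * ddot (grad u x) (grad v x)).

Definition normT kap u : R := Num.sqrt (ipT kap u u).

Definition normL2 (p : 'rV[R]_d -> R) : R :=
  Num.sqrt (\int[leb]_(x in Om) (p x ^+ 2)).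

Definition normX kap (U : state) : R :=
  Num.sqrt (normT kap U.1 ^+ 2 + normL2 U.2 ^+ 2).

Definition T_norm_equiv_H1 kap :=
  exists c C : R, [/\ 0 < c, 0 < C &
    forall v, inY v ->
      leb.-integrable Om
        (EFin \o (fun x => kap x * ddot (grad v x) (grad v x))) /\
      c * normH1 Om v <= normT kap v <= C * normH1 Om v].

Definition opA0 (u v : vfield) : R :=
  \int[leb]_(x in Om) (ddot (grad u x) (grad v x)).

Definition opA1 (U V : state) : R :=
  \int[leb]_(x in Om) (div U.1 x * V.2 x - div V.1 x * U.2 x)
  + \int[leb]_(x in Om) (advect (uD pb) U.1 V.1 x)
  + \int[leb]_(x in Om) (advect U.1 (uD pb) V.1 x).

Definition opA2 (U V : state) : R :=
  \int[leb]_(x in Om) (advect U.1 U.1 V.1 x).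

Definition opA3 (U V : state) : R :=
  \int[leb]_(x in Om)
    (nuT (U.1 + uD pb) x * ddot (grad (U.1 + uD pb) x) (grad V.1 x)).

Definition opA (mu : R) (U V : state) : R :=
  mu^-1 * opA0 U.1 V.1 + opA1 U V + opA2 U V + opA3 U V.

Definition opF (mu : R) (V : state) : R :=
  \int[leb]_(x in Om) (dot (force pb x) (fld V.1 x))
  - mu^-1 * \int[leb]_(x in Om) (ddot (grad (uD pb) x) (grad V.1 x))
  - \int[leb]_(x in Om) (advect (uD pb) (uD pb) V.1 x).

(* Derivative of [opA mu ^~ V] at [U] in the direction [Z].  In the last term
   [_ / 0 = 0], so the integrand vanishes where the gradient does. *)
Definition opdA (mu : R) (U V Z : state) : R :=
  mu^-1 * opA0 Z.1 V.1 + opA1 Z V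
  + \int[leb]_(x in Om) (advect U.1 Z.1 V.1 x)
  + \int[leb]_(x in Om) (advect Z.1 U.1 V.1 x)
  + \int[leb]_(x in Om)
      (nuT (U.1 + uD pb) x * ddot (grad Z.1 x) (grad V.1 x))
  + \sum_k \int[leb]_(x in KO k)
      ((CS pb * h_ k) ^+ 2
       * (ddot (grad (U.1 + uD pb) x) (grad Z.1 x)
          / fnorm (grad (U.1 + uD pb) x))
       * ddot (grad (U.1 + uD pb) x) (grad V.1 x)).

Definition solves (mu : R) (S : set state) (U : state) :=
  S U /\ forall V, S V -> opA mu U V = opF mu V.

Definition is_supremizer kap (Yh : set vfield) (Mh : set ('rV[R]_d -> R))
    (Tp : ('rV[R]_d -> R) -> vfield) :=
  forall q, Mh q -> Yh (Tp q) /\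
    forall v, Yh v -> ipT kap (Tp q) v = - \int[leb]_(x in Om) (div v x * q x).

Definition rb_space (Tp : ('rV[R]_d -> R) -> vfield) N (snap : 'I_N -> state)
    : set state :=
  span (fun s : 'I_N + 'I_N =>
    match s with inl k => (snap k).1 | inr k => Tp (snap k).2 end)
  `*` span (fun k => (snap k).2).

Definition nonzero (S : set state) := [set V | S V /\ ~ ae_eq_state Om V 0].

Definition dual_norm kap (Xh : set state) (L : state -> R) : R :=
  sup [set L V / normX kap V | V in nonzero Xh].

Definition betaN kap (Xh : set state) (mu : R) (U : state) : R :=
  inf [set sup [set opdA mu U V Z / (normX kap Z * normX kap V)
                | V in nonzero Xh] | Z in nonzero Xh].

Definition gammaN kap (Xh : set state) (mu : R) (U : state) : R :=
  sup [set sup [set opdA mu U V Z / (normX kap Z * normX kap V)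
                | V in nonzero Xh] | Z in nonzero Xh].

Definition residual (mu : R) (U V : state) : R := opA mu U V - opF mu V.

Definition epsilonN kap Xh mu U : R := dual_norm kap Xh (residual mu U).

Definition tauN kap Xh (rhoT mu : R) U : R :=
  4 * epsilonN kap Xh mu U * rhoT / betaN kap Xh mu U ^+ 2.

Definition DeltaN kap Xh (rhoT mu : R) U : R :=
  betaN kap Xh mu U / (2 * rhoT) * (1 - Num.sqrt (1 - tauN kap Xh rhoT mu U)).

End smagorinsky.

(* Main.v *)
Require Import Defs.
From HB Require Import structures.
From mathcomp Require Import all_boot all_order all_algebra.
From mathcomp Require Import all_classical all_reals all_analysis.
From mathcomp Require Import measurable_realfun ring lra.
From mathcomp Require mpoly.
Set Implicit Arguments.
Unset Strict Implicit.
Unset Printing Implicit Defensive.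
Import Order.TTheory GRing.Theory Num.Theory.
Import numFieldNormedType.Exports.
Local Open Scope classical_set_scope.
Local Open Scope ring_scope.

(**
Let B be the derivative of the operator at the reduced basis solution U_N.  As
the discrete space is finite-dimensional, the inf-sup bound makes B invertible,
and discrete solutions are the fixed points of U |-> U - B^-1 R(U).  The
mean value theorem and the Lipschitz bound on the derivative give
|R(U2) - R(U1) - B(U2 - U1)| <= rho r |U2 - U1| on the ball of radius r around
U_N.  The radius r = Delta_N is the smaller root of rho r^2 + eps = beta r, and
it satisfies rho r <= beta / 2: on that ball the map is a self-map and contracts
with factor 1/2, even when tau_N = 1.  Effectivity follows from
Delta_N <= 2 eps / beta and eps <= gamma |e| + rho |e|^2.

The derivative of the operator is justified by a pointwise quadratic remainder
for G |-> |G| G, integrable because finite element functions are essentially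
bounded while the lift u_D is only in H^1.
*)

(** * Finite-dimensional seminormed spaces *)

(** States are pairs of functions rather than classes modulo null sets, so [normX] is only a
    seminorm: coordinates are taken in a basis modulo null states, every form is shown to vanish on
    such states, and uniqueness means equality almost everywhere. Real [sup] and [inf] carry
    information only on non-empty bounded sets. Boundedness of the quotients behind [betaN],
    [gammaN] and [epsilonN] comes from norm equivalence in finite dimension, non-emptiness from
    [betaN > 0]. The mean value theorem is applied to the scalar function obtained by fixing the
    test state. The intermediate point depends on that test state, which is harmless because the
    Lipschitz bound is uniform over the discrete space. *)

Lemma lipschitz_within_continuous (R : realType) (V W : normedModType R)
    (A : set V) (f : V -> W) (C : R) :
  (forall x y, A x -> A y -> `|f x - f y| <= C * `|x - y|) ->
  {within A, continuous f}.
Proof.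
move=> fC; apply/subspace_continuousP => x Ax.
apply/cvgrPdist_le => /= e e0; rewrite near_withinE.
(* [C] may be nonpositive, so the neighbourhood is chosen with [max C 1]. *)
have C0 : 0 < Num.max C 1 by rewrite lt_max ltr01 orbT.
near=> y => Ay; apply: (le_trans (fC _ _ Ax Ay)).
apply: (@le_trans _ _ (Num.max C 1 * `|x - y|)).
  by rewrite ler_wpM2r// le_max lexx.
rewrite mulrC -ler_pdivlMr// -normrN opprB distrC.
by near: y; apply: cvgr_dist_le => //; rewrite divr_gt0.
Unshelve. all: by end_near. Qed.

(** Dividing the remainder by the increment leaves at most [C] times its size. The expansions of the
    operator are proved as such remainder bounds. *)
Lemma is_derive_quadratic (R : realType) (f : R -> R) (x l C : R) :
  (forall s, `|f (x + s) - f x - s * l| <= C * s ^+ 2) -> is_derive x 1 f l.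
Proof.
move=> fC.
have cv : (fun h => h^-1 *: ((f \o shift x) (h *: (1 : R)) - f x)) @ 0^' --> l.
  apply/cvgrPdist_le => /= e e0.
  have C0 : 0 < Num.max C 1 by rewrite lt_max ltr01 orbT.
  near=> h.
  have h0 : h != 0 by near: h; exact: nbhs_dnbhs_neq.
  have := fC h; rewrite /shift/= /GRing.scale/= mulr1 [h + x]addrC.
  rewrite (_ : l - _ = - (h^-1 * (f (x + h) - f x - h * l))); last first.
    by rewrite [in RHS]mulrBr mulKf// opprB.
  move=> H; rewrite normrN normrM normfV ler_pdivrMl ?normr_gt0//.
  apply: (le_trans H); rewrite -normr_id -real_normK ?num_real// expr2 mulrCA.
  rewrite normr_id ler_wpM2l//.
  apply: (@le_trans _ _ (Num.max C 1 * `|h|)).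
    by rewrite ler_wpM2r// le_max lexx.
  rewrite mulrC -ler_pdivlMr//.
  near: h; apply: dnbhs0_le; by rewrite divr_gt0.
split; first by apply/cvg_ex; exists l.
exact: cvg_lim.
Unshelve. all: by end_near. Qed.

Definition subspace_set (R : realType) (V : lmodType R) (S : set V) :=
  S 0 /\ forall a u v, S u -> S v -> S (a *: u + v).

(** Integrals are additive only on integrable functions, so homogeneity and the triangle inequality,
    like linearity below, are required on [S] only. *)
Definition seminorm_on (R : realType) (V : lmodType R) (S : set V)
    (nrm : V -> R) :=
  [/\ forall v, 0 <= nrm v,
      forall a v, S v -> nrm (a *: v) = `|a| * nrm v &
      forall u v, S u -> S v -> nrm (u + v) <= nrm u + nrm v].

Definition linear_on (R : realType) (V : lmodType R) (S : set V) (L : V -> R) :=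
  forall a u v, S u -> S v -> L (a *: u + v) = a * L u + L v.

Definition comb (R : realType) (V : lmodType R) n (e : 'I_n -> V) (c : 'rV[R]_n) :=
  \sum_i c 0 i *: e i.

Section combinations.
Context (R : realType) (V : lmodType R) (S : set V).
Hypothesis SS : subspace_set S.

Lemma subspace0 : S 0. Proof. by case: SS. Qed.

Lemma subspaceD u v : S u -> S v -> S (u + v).
Proof. by move=> ? ?; rewrite -[u]scale1r; apply: (SS.2). Qed.

Lemma subspaceZ a u : S u -> S (a *: u).
Proof. by move=> ?; rewrite -[_ *: _]addr0; apply: (SS.2) => //; case: SS. Qed.

Lemma subspaceN u : S u -> S (- u).
Proof. by rewrite -scaleN1r; exact: subspaceZ. Qed.

Lemma subspaceB u v : S u -> S v -> S (u - v).
Proof. by move=> ? ?; apply: subspaceD => //; apply: subspaceN. Qed.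

Lemma subspace_comb n (e : 'I_n -> V) c : (forall i, S (e i)) -> S (comb e c).
Proof.
move=> eS; apply: (big_ind S) => [|u v|i _]; first exact: subspace0.
  exact: subspaceD.
exact: subspaceZ.
Qed.

Lemma combP n (e : 'I_n -> V) a c c' :
  comb e (a *: c + c') = a *: comb e c + comb e c'.
Proof.
rewrite /comb scaler_sumr -big_split/=; apply: eq_bigr => i _.
by rewrite !mxE scalerDl scalerA.
Qed.

Lemma combB n (e : 'I_n -> V) c c' : comb e (c - c') = comb e c - comb e c'.
Proof.
by rewrite (_ : c - c' = -1 *: c' + c) ?combP scaleN1r addrC.
Qed.

Lemma combZ n (e : 'I_n -> V) a c : comb e (a *: c) = a *: comb e c.
Proof.
rewrite /comb scaler_sumr; apply: eq_bigr => i _.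
by rewrite !mxE scalerA.
Qed.

Section linear_on.
Variable L : V -> R.
Hypothesis linL : linear_on S L.

Lemma lin0 : L 0 = 0.
Proof.
have := linL 1 subspace0 subspace0.
by rewrite scale1r addr0 mul1r => /eqP; rewrite -subr_eq subrr eq_sym => /eqP.
Qed.

Lemma linD u v : S u -> S v -> L (u + v) = L u + L v.
Proof. by move=> Su Sv; rewrite -[u in LHS]scale1r linL// mul1r. Qed.

Lemma linZ a u : S u -> L (a *: u) = a * L u.
Proof.
by move=> Su; rewrite -[_ *: _]addr0 linL// ?lin0 ?addr0//; exact: subspace0.
Qed.

Lemma linN u : S u -> L (- u) = - L u.
Proof. by move=> Su; rewrite -scaleN1r linZ// mulN1r. Qed.

Lemma linB u v : S u -> S v -> L (u - v) = L u - L v.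
Proof. by move=> Su Sv; rewrite linD ?linN//; exact: subspaceN. Qed.

Lemma lin_comb n (e : 'I_n -> V) c : (forall i, S (e i)) ->
  L (comb e c) = \sum_i c 0 i * L (e i).
Proof.
move=> eS; rewrite /comb.
suff : S (\sum_i c 0 i *: e i) /\
    L (\sum_i c 0 i *: e i) = \sum_i c 0 i * L (e i) by case.
apply: (big_ind2 (fun v r => S v /\ L v = r)).
- by rewrite lin0; split => //; exact: subspace0.
- by move=> u r v s [Su <-] [Sv <-]; rewrite linD//; split => //; exact: subspaceD.
- by move=> i _; rewrite linZ//; split => //; exact: subspaceZ.
Qed.

End linear_on.

Section seminorm.
Variable nrm : V -> R.
Hypothesis snrm : seminorm_on S nrm.

Lemma snrm_ge0 v : 0 <= nrm v. Proof. by case: snrm. Qed.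

Lemma snrmZ a v : S v -> nrm (a *: v) = `|a| * nrm v.
Proof. by case: snrm => _ + _; apply. Qed.

Lemma snrmD u v : S u -> S v -> nrm (u + v) <= nrm u + nrm v.
Proof. by case: snrm => _ _; apply. Qed.

Lemma snrm0 : nrm 0 = 0.
Proof. by rewrite -(scale0r (0 : V)) snrmZ ?normr0 ?mul0r//; exact: subspace0. Qed.

Lemma snrmN v : S v -> nrm (- v) = nrm v.
Proof. by move=> Sv; rewrite -scaleN1r snrmZ// normrN1 mul1r. Qed.

Lemma snrmB u v : S u -> S v -> nrm (u - v) <= nrm u + nrm v.
Proof. by move=> Su Sv; rewrite -(snrmN Sv) snrmD//; exact: subspaceN. Qed.

Lemma snrm_dist u v : S u -> S v -> `|nrm u - nrm v| <= nrm (u - v).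
Proof.
move=> Su Sv; rewrite ler_norml; apply/andP; split.
  rewrite -[nrm (u - v)]snrmN ?opprB; last exact: subspaceB.
  rewrite lerBrDr addrC lerBlDr addrC -{1}(subrK u v) snrmD//.
  exact: subspaceB.
by rewrite lerBlDr -{1}(subrK v u) snrmD//; exact: subspaceB.
Qed.

Lemma ler_coord_norm n (c : 'rV[R]_n) i : `|c 0 i| <= `|c|.
Proof.
rewrite [leRHS]/Num.norm/= mx_normrE; apply: (@le_bigmax _ _ _ _ (fun ij => `|c ij.1 ij.2|) (0, i)).
Qed.

Lemma snrm_comb_le n (e : 'I_n -> V) c : (forall i, S (e i)) ->
  nrm (comb e c) <= (\sum_i nrm (e i)) * `|c|.
Proof.
move=> eS; rewrite mulr_suml /comb.
suff : S (\sum_i c 0 i *: e i) /\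
    nrm (\sum_i c 0 i *: e i) <= \sum_i nrm (e i) * `|c| by case.
apply: (big_ind2 (fun v r => S v /\ nrm v <= r)).
- by rewrite snrm0; split => //; exact: subspace0.
- move=> u r v s [Su ur] [Sv vs]; split; first exact: subspaceD.
  by rewrite (le_trans (snrmD _ _))// lerD.
- move=> i _; rewrite snrmZ//; split; first exact: subspaceZ.
  by rewrite mulrC ler_wpM2l ?snrm_ge0// ler_coord_norm.
Qed.

(* Basis modulo the null vectors of [nrm]. *)
Definition is_basis n (e : 'I_n -> V) :=
  [/\ forall i, S (e i),
      forall v, S v -> exists c, nrm (v - comb e c) = 0 &
      forall c, nrm (comb e c) = 0 -> c = 0].

(** A shortest family generating [S] modulo null vectors is independent modulo null vectors: a
    nontrivial null combination would allow one member to be dropped. *)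
Lemma basis_exists : fin_dim S -> exists n (e : 'I_n -> V), is_basis e.
Proof.
move=> [m [b Sb]].
pose gen n := exists e : 'I_n -> V, (forall i, S (e i)) /\
  forall v, S v -> exists c, nrm (v - comb e c) = 0.
have genm : gen m.
  exists b; split.
    move=> i; rewrite Sb; exists (fun j => (j == i)%:R).
    rewrite (bigD1 i)//= eqxx scale1r big1 ?addr0// => j /negbTE ->.
    by rewrite scale0r.
  move=> v; rewrite {1}Sb => -[c ->]; exists (\row_i c i).
  rewrite (_ : comb _ _ = \sum_i c i *: b i) ?subrr ?snrm0//.
  by apply: eq_bigr => i _; rewrite mxE.
have exg : exists n, `[< gen n >] by exists m; apply/asboolP.
case: (ex_minnP exg) => n /asboolP[e [eS egen]] nmin.
exists n, e; split => // c nc; apply/rowP => i0; rewrite mxE.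
apply/eqP/negP => /negP ci0.
case: n e eS egen nmin c nc i0 ci0 => [|n] e eS egen nmin c nc i0 ci0.
  by case: i0 ci0.
suff /asboolP/nmin : gen n by rewrite ltnn.
exists (fun j => e (lift i0 j)); split => // v Sv.
have [a ac] := egen v Sv.
(* Subtracting a multiple of [c] alters the combination by a null vector only and makes its
   coordinate [i0] vanish. *)
pose a' := a - (a 0 i0 / c 0 i0) *: c.
exists (\row_j a' 0 (lift i0 j)).
have -> : comb (fun j => e (lift i0 j)) (\row_j a' 0 (lift i0 j)) = comb e a'.
  rewrite /comb (bigD1_ord i0)//= {1}/a' !mxE divfK// subrr scale0r add0r.
  by apply: eq_bigr => j _; rewrite mxE.
apply/eqP; rewrite eq_le snrm_ge0 andbT.
rewrite /a' combB opprB addrCA addrC.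
apply: (le_trans (snrmD _ _)).
- by apply: subspaceB => //; exact: subspace_comb.
- exact: subspace_comb.
by rewrite ac combZ snrmZ ?nc ?mulr0 ?addr0//; exact: subspace_comb.
Qed.

Section basis.
Context n (e : 'I_n -> V).
Hypothesis be : is_basis e.

Let eS i : S (e i). Proof. by case: be. Qed.

Lemma continuous_snrm_comb A : {within A, continuous (fun c => nrm (comb e c))}.
Proof.
apply: lipschitz_within_continuous => x y _ _.
  rewrite (le_trans (snrm_dist _ _))//; try exact: subspace_comb.
  by rewrite -combB; exact: snrm_comb_le.
Qed.

(** Norm equivalence: on the compact unit sphere of coordinates the seminorm attains its minimum,
    positive by independence modulo null vectors; homogeneity does the rest. *)
Lemma comb_lower_bound : exists2 a, 0 < a & forall c, a * `|c| <= nrm (comb e c).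
Proof.
pose A : set 'rV[R]_n := [set c | `|c| = 1].
(* If the sphere is empty, every [c] is 0 and any constant serves. *)
have [[c0 Ac0]|A0] := pselect (A !=set0); last first.
  exists 1 => // c; have [->|c0] := eqVneq c 0; first by rewrite normr0 mulr0 snrm_ge0.
  exfalso; apply: A0; exists (`|c|^-1 *: c); rewrite /A/= normrZ normfV normr_id.
  by rewrite mulVf// normr_eq0.
have cA : compact A.
  apply: bounded_closed_compact.
    exists 1; split; first exact: num_real.
    by move=> x x1 c /= ->; exact: ltW.
  rewrite (_ : A = Num.norm @^-1` [set 1])//.
  by apply: closed_comp => [x _|]; [exact: norm_continuous|exact: closed_eq].
have [] := @EVT_min_rV R n (fun c => nrm (comb e c)) A _ cA.
- by exists c0.
- exact: continuous_snrm_comb.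
move=> c; rewrite inE => Ac cmin.
exists (nrm (comb e c)).
  rewrite lt_neqAle snrm_ge0 andbT eq_sym; apply/eqP => /(let: And3 _ _ h := be in h) c00.
  by move: Ac; rewrite /A/= c00 normr0 => /esym/eqP; rewrite oner_eq0.
move=> d; have [->|d0] := eqVneq d 0; first by rewrite normr0 mulr0 snrm_ge0.
have nd : 0 < `|d| by rewrite normr_gt0.
rewrite -ler_pdivlMr// mulrC -[`|d|^-1]ger0_norm ?invr_ge0//.
rewrite -snrmZ; last exact: subspace_comb.
rewrite -combZ; apply: cmin; rewrite inE /A/= normrZ normfV normr_id.
by rewrite mulVf// normr_eq0.
Qed.

Lemma null_lin_eq L v c : linear_on S L -> (forall v, S v -> nrm v = 0 -> L v = 0) ->
  S v -> nrm (v - comb e c) = 0 -> L v = L (comb e c).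
Proof.
move=> linL L0 Sv vc.
have Sc : S (comb e c) by exact: subspace_comb.
by apply/eqP; rewrite -subr_eq0 -linB//; apply/eqP/L0 => //; exact: subspaceB.
Qed.

Lemma null_nrm_eq v c : S v -> nrm (v - comb e c) = 0 -> nrm v = nrm (comb e c).
Proof.
move=> Sv vc; have Sc : S (comb e c) by exact: subspace_comb.
apply/eqP; rewrite -subr_eq0 -normr_eq0 -normr_le0 normr_id -vc.
exact: snrm_dist.
Qed.

End basis.

Hypothesis fS : fin_dim S.

(** Vanishing on null vectors lets [L] factor through the coordinates, which [comb_lower_bound]
    controls by the seminorm. *)
Lemma linear_bounded L : linear_on S L -> (forall v, S v -> nrm v = 0 -> L v = 0) ->
  exists2 C, 0 <= C & forall v, S v -> `|L v| <= C * nrm v.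
Proof.
move=> linL L0; have [n [e be]] := basis_exists fS.
have [a a0 ac] := comb_lower_bound be.
have [eS egen _] := be.
have s0 : 0 <= \sum_i `|L (e i)| by exact: sumr_ge0.
exists ((\sum_i `|L (e i)|) / a); first by rewrite divr_ge0// ltW.
move=> v Sv; have [c vc] := egen v Sv.
rewrite (null_lin_eq be linL L0 Sv vc) (null_nrm_eq be Sv vc).
rewrite lin_comb// (le_trans (ler_norm_sum _ _ _))//.
apply: (@le_trans _ _ (\sum_i `|L (e i)| * `|c|)).
  by apply: ler_sum => i _; rewrite normrM mulrC ler_wpM2l// ler_coord_norm.
by rewrite -mulr_suml -mulrA ler_wpM2l// ler_pdivlMl// mulrC mulrC ac.
Qed.

(** [linear_bounded] in the second argument for each basis vector, then the coordinate bound in the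
    first. *)
Lemma bilinear_bounded (B : V -> V -> R) :
  (forall u, S u -> linear_on S (B u)) -> (forall v, S v -> linear_on S (B ^~ v)) ->
  (forall u v, S u -> S v -> nrm u = 0 -> B u v = 0) ->
  (forall u v, S u -> S v -> nrm v = 0 -> B u v = 0) ->
  exists2 C, 0 <= C & forall u v, S u -> S v -> `|B u v| <= C * nrm u * nrm v.
Proof.
move=> linr linl B0l B0r; have [n [e be]] := basis_exists fS.
have [a a0 ac] := comb_lower_bound be.
have [eS egen _] := be.
have /fin_all_exists2[C C0 CB] i : exists2 C, 0 <= C &
    forall v, S v -> `|B (e i) v| <= C * nrm v.
  by apply: linear_bounded => [|v Sv v0]; [exact: linr|exact: B0r].
have s0 : 0 <= \sum_i C i by exact: sumr_ge0.
exists ((\sum_i C i) / a); first by rewrite divr_ge0// ltW.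
move=> u v Su Sv; have [c uc] := egen u Su.
rewrite (null_lin_eq be (linl _ Sv) _ Su uc); last by move=> w Sw w0; exact: B0l.
rewrite (null_nrm_eq be Su uc).
rewrite (lin_comb (linl _ Sv))// (le_trans (ler_norm_sum _ _ _))//.
apply: (@le_trans _ _ (\sum_i C i * (`|c| * nrm v))).
  apply: ler_sum => i _; rewrite normrM mulrCA.
  by rewrite ler_pM// ?ler_coord_norm ?CB.
rewrite -mulr_suml mulrA ler_wpM2r ?snrm_ge0//.
by rewrite -mulrA ler_wpM2l// ler_pdivlMl// ac.
Qed.

End seminorm.
End combinations.

(** * Cauchy-Schwarz for possibly degenerate nonnegative forms *)

Section psd_form.
Context (R : realType) (V : lmodType R) (S : set V) (b : V -> V -> R).
Hypothesis SS : subspace_set S.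
Hypothesis b_lin : forall v, S v -> linear_on S (b ^~ v).
Hypothesis b_sym : forall u v, b u v = b v u.
Hypothesis b_ge0 : forall u, 0 <= b u u.

Lemma psd_quad s t u v : S u -> S v ->
  b (s *: u + t *: v) (s *: u + t *: v) =
  s ^+ 2 * b u u + 2 * s * t * b u v + t ^+ 2 * b v v.
Proof.
move=> Su Sv.
have Ssu := subspaceZ SS s Su; have Stv := subspaceZ SS t Sv.
have Sst := subspaceD SS Ssu Stv.
rewrite b_lin// (linZ SS (b_lin Sst))// !(b_sym _ (_ + _)).
rewrite !b_lin// !(linZ SS (b_lin _))// (b_sym v u); ring.
Qed.

Lemma psd_cauchy_schwarz u v : S u -> S v -> b u v ^+ 2 <= b u u * b v v.
Proof.
move=> Su Sv; have [v0|v0] := eqVneq (b v v) 0; last first.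
  have vp : 0 < b v v by rewrite lt_neqAle eq_sym v0 b_ge0.
  have := b_ge0 (b v v *: u + (- b u v) *: v); rewrite psd_quad//.
  rewrite (_ : _ + _ = b v v * (b u u * b v v - b u v ^+ 2)); last by ring.
  by rewrite pmulr_rge0// subr_ge0.
(* When [b v v = 0] the quadratic is affine in the coefficient of [v]; this choice makes it equal to
   [- b u v ^+ 2]. *)
have := b_ge0 (b u v *: u + (- (b u u + 1) / 2) *: v); rewrite psd_quad// v0.
rewrite (_ : _ + _ = - b u v ^+ 2); last by field.
by rewrite oppr_ge0 mulr0.
Qed.

Lemma psd_norm_cauchy_schwarz u v : S u -> S v ->
  `|b u v| <= Num.sqrt (b u u) * Num.sqrt (b v v).
Proof.
move=> Su Sv; rewrite -sqrtr_sqr -sqrtrM// ler_wsqrtr//.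
exact: psd_cauchy_schwarz.
Qed.

Lemma psd_seminorm : seminorm_on S (fun v => Num.sqrt (b v v)).
Proof.
split=> [v|a v Sv|u v Su Sv]; first exact: sqrtr_ge0.
  rewrite -[_ *: _]addr0 -[X in _ + X](scale0r v) psd_quad//.
  rewrite expr0n !mul0r !mulr0 mul0r !addr0 sqrtrM ?sqr_ge0//.
  by rewrite sqrtr_sqr.
rewrite -[leRHS]ger0_norm ?addr_ge0 ?sqrtr_ge0// -sqrtr_sqr ler_wsqrtr//.
rewrite -{1 2}[u]scale1r -{1 2}[v]scale1r psd_quad// sqrrD !sqr_sqrtr//.
have := psd_norm_cauchy_schwarz Su Sv; rewrite ler_norml => /andP[_].
by rewrite mulr2n; lra.
Qed.

End psd_form.

(** * Approximate zeros of nonlinear operators *)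

Section brezzi_rappaz_raviart.
Context (R : realType) (V : lmodType R) (S : set V) (nrm : V -> R).
Hypotheses (SS : subspace_set S) (fS : fin_dim S) (snrm : seminorm_on S nrm).
Context (res : V -> V -> R) (dres : V -> V -> V -> R) (U0 : V) (rho : R).
Hypothesis (SU0 : S U0) (rho0 : 0 < rho).
Hypothesis res_lin : forall U, S U -> linear_on S (res U).
Hypothesis res_null : forall U v, S U -> S v -> nrm v = 0 -> res U v = 0.
Hypothesis dres_linl : forall z, S z -> linear_on S (fun v => dres U0 v z).
Hypothesis dres_linr : forall v, S v -> linear_on S (dres U0 v).
Hypothesis dres_nulll : forall v z, S v -> S z -> nrm v = 0 -> dres U0 v z = 0.
Hypothesis dres_nullr : forall v z, S v -> S z -> nrm z = 0 -> dres U0 v z = 0.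
Hypothesis mean_value : forall U1 U2 v, S U1 -> S U2 -> S v ->
  exists2 t, 0 <= t <= 1 &
    res U2 v - res U1 v = dres (U1 + t *: (U2 - U1)) v (U2 - U1).
Hypothesis dres_lip : forall U z v, S U -> S z -> S v ->
  `|dres U v z - dres U0 v z| <= rho * nrm (U - U0) * nrm z * nrm v.

Definition nonnull := [set v | S v /\ nrm v <> 0].

(** [dres U v z] is the derivative at [U] in the direction [z], tested against [v], so the outer
    infimum runs over directions. *)
Definition infsup := inf [set sup [set dres U0 v z / (nrm z * nrm v)
  | v in nonnull] | z in nonnull].

Definition supsup := sup [set sup [set dres U0 v z / (nrm z * nrm v)
  | v in nonnull] | z in nonnull].

Definition residual_norm := sup [set res U0 v / nrm v | v in nonnull].

Local Notation beta := infsup.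
Local Notation gamma := supsup.
Local Notation eps := residual_norm.

Hypothesis beta_gt0 : 0 < beta.

(** An infimum over the empty set is 0, which [beta_gt0] excludes. *)
Lemma nonnull_neq0 : nonnull !=set0.
Proof.
apply/set0P/eqP => E; move: beta_gt0.
by rewrite /infsup E image_set0 inf0 ltxx.
Qed.

Lemma nonnull_gt0 v : nonnull v -> 0 < nrm v.
Proof. by case=> Sv /eqP v0; rewrite lt_neqAle eq_sym v0 (snrm_ge0 snrm). Qed.

Lemma dres_bounded : exists2 C, 0 <= C &
  forall v z, S v -> S z -> `|dres U0 v z| <= C * nrm v * nrm z.
Proof.
exact: (bilinear_bounded SS snrm fS).
Qed.

Lemma quotients_ubound C z : nonnull z ->
    (forall v, S v -> `|dres U0 v z| <= C * nrm v * nrm z) ->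
  ubound [set dres U0 v z / (nrm z * nrm v) | v in nonnull] C.
Proof.
move=> nz CB _ [v nv <-].
rewrite ler_pdivrMr ?mulr_gt0 ?nonnull_gt0//.
by rewrite (le_trans (ler_norm _))// [nrm z * _]mulrC mulrA CB//; case: nv.
Qed.

Lemma quotients_neq0 z :
  [set dres U0 v z / (nrm z * nrm v) | v in nonnull] !=set0.
Proof. by have [v nv] := nonnull_neq0; exists (dres U0 v z / (nrm z * nrm v)), v. Qed.

(** The inf-sup condition in the form used for existence and uniqueness: control of the derivative
    against all tests [v] controls the direction [z]. *)
Lemma infsup_le z K : S z -> 0 <= K ->
  (forall v, S v -> `|dres U0 v z| <= K * nrm v) -> beta * nrm z <= K.
Proof.
move=> Sz K0 zK; have [->|/eqP z0] := eqVneq (nrm z) 0; first by rewrite mulr0.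
have nz : nonnull z by [].
have zp := nonnull_gt0 nz.
rewrite -ler_pdivlMr//; apply: (@le_trans _ _
    (sup [set dres U0 v z / (nrm z * nrm v) | v in nonnull])).
  apply: ge_inf; last by exists z.
  have [C C0 CB] := dres_bounded.
  (* [ge_inf] needs a lower bound for the inner suprema: each dominates one of its quotients, and
     all quotients are at least [- C]. *)
  exists (- C) => _ [y ny <-].
  have [v nv] := nonnull_neq0.
  apply: (@le_trans _ _ (dres U0 v y / (nrm y * nrm v))).
    rewrite ler_pdivlMr ?mulr_gt0 ?nonnull_gt0//.
    rewrite mulNr lerNl (le_trans _ (_ : `|dres U0 v y| <= _))//.
      by rewrite -normrN ler_norm.
    by rewrite [nrm y * _]mulrC mulrA CB//; [case: nv|case: ny].
  apply: ub_le_sup; last by exists v.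
  by exists C; apply: quotients_ubound => // u Su; apply: CB => //; case: ny.
apply: ge_sup; first exact: quotients_neq0.
apply: quotients_ubound => // v Sv.
by rewrite mulrAC divfK ?zK// gt_eqF.
Qed.

(** The quotients carry no absolute value, so the lower bound comes from testing against [- v]; null
    vectors, absent from the quotients, make [dres] vanish. *)
Lemma dres_le_supsup v z : S v -> S z -> `|dres U0 v z| <= gamma * nrm v * nrm z.
Proof.
move=> Sv Sz.
have [v0|/eqP v0] := eqVneq (nrm v) 0.
  by rewrite dres_nulll// v0 mulr0 mul0r normr0.
have [z0|/eqP z0] := eqVneq (nrm z) 0.
  by rewrite dres_nullr// z0 mulr0 normr0.
have [C C0 CB] := dres_bounded.
have nz : nonnull z by [].
have zp := nonnull_gt0 nz.
suff H w : S w -> nrm w <> 0 -> dres U0 w z <= gamma * nrm w * nrm z.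
  rewrite ler_norml H// andbT lerNl.
  have Sw := subspaceN SS Sv.
  by rewrite -(linN SS (dres_linl Sz))// -(snrmN snrm Sv) H// (snrmN snrm).
move=> Sw w0; have nw : nonnull w by [].
have wp := nonnull_gt0 nw.
rewrite -mulrA [nrm w * _]mulrC -ler_pdivrMr ?mulr_gt0//.
apply: (@le_trans _ _ (sup [set dres U0 v z / (nrm z * nrm v) | v in nonnull])).
  apply: ub_le_sup; last by exists w.
  by exists C; apply: quotients_ubound => // u Su; exact: CB.
apply: ub_le_sup; last by exists z.
exists C => _ [y ny <-]; apply: ge_sup; first exact: quotients_neq0.
by apply: quotients_ubound => // u Su; apply: CB => //; case: ny.
Qed.

(** [linear_bounded] makes the supremum meaningful; the absolute value again comes from [- v]. *)
Lemma res_le_residual_norm v : S v -> `|res U0 v| <= eps * nrm v.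
Proof.
move=> Sv; have [v0|/eqP v0] := eqVneq (nrm v) 0.
  by rewrite res_null// v0 mulr0 normr0.
have [C C0 CB] := linear_bounded SS snrm fS (res_lin SU0) (fun v => @res_null U0 v SU0).
suff H w : S w -> nrm w <> 0 -> res U0 w <= eps * nrm w.
  rewrite ler_norml H// andbT lerNl.
  have Sw := subspaceN SS Sv.
  by rewrite -(linN SS (res_lin SU0))// -(snrmN snrm Sv) H// (snrmN snrm).
move=> Sw w0; have nw : nonnull w by [].
rewrite -ler_pdivrMr ?nonnull_gt0//; apply: ub_le_sup; last by exists w.
exists C => _ [y ny <-]; rewrite ler_pdivrMr ?nonnull_gt0//.
by rewrite (le_trans (ler_norm _))// CB//; case: ny.
Qed.

Lemma residual_norm_ge0 : 0 <= eps.
Proof.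
have [v nv] := nonnull_neq0; have [Sv _] := nv.
by rewrite -(pmulr_lge0 _ (nonnull_gt0 nv)) (le_trans _ (res_le_residual_norm Sv)).
Qed.

(** The intermediate point lies in the ball of radius [r] because balls of a seminorm are convex. It
    depends on [v], but the factor [rho * r] does not. *)
Lemma linearization_error r U1 U2 v : S U1 -> S U2 -> S v ->
  nrm (U1 - U0) <= r -> nrm (U2 - U0) <= r ->
  `|res U2 v - res U1 v - dres U0 v (U2 - U1)|
    <= rho * r * nrm (U2 - U1) * nrm v.
Proof.
move=> S1 S2 Sv r1 r2; have [t /andP[t0 t1] ->] := mean_value S1 S2 Sv.
have S21 : S (U2 - U1) by exact: subspaceB.
have St : S (U1 + t *: (U2 - U1)) by apply: subspaceD => //; exact: subspaceZ.
rewrite (le_trans (dres_lip _ _ _))//.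
rewrite !ler_wpM2r ?(snrm_ge0 snrm)// ler_wpM2l ?(ltW rho0)//.
rewrite (_ : _ - U0 = (1 - t) *: (U1 - U0) + t *: (U2 - U0)); last first.
  rewrite -[U2 - U1](_ : (U2 - U0) - (U1 - U0) = _); last first.
    by rewrite opprB addrA subrK.
  by rewrite scalerBr scalerBl scale1r addrAC addrA [RHS]addrAC.
have S1' : S (U1 - U0) by exact: subspaceB.
have S2' : S (U2 - U0) by exact: subspaceB.
rewrite (le_trans (snrmD snrm _ _))//; try exact: subspaceZ.
rewrite !(snrmZ snrm)// !ger0_norm ?subr_ge0//.
have := ler_wpM2l t0 r2.
have : (1 - t) * nrm (U1 - U0) <= (1 - t) * r by rewrite ler_wpM2l// subr_ge0.
by lra.
Qed.

Definition tau := 4 * eps * rho / beta ^+ 2.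
(* The smaller root of [rho * r ^+ 2 - beta * r + eps], see [radius_root]. *)
Definition error_radius := beta / (2 * rho) * (1 - Num.sqrt (1 - tau)).
Hypothesis tau_le1 : tau <= 1.

Lemma tau_ge0 : 0 <= tau.
Proof. by rewrite /tau !mulr_ge0 ?invr_ge0 ?sqr_ge0 ?residual_norm_ge0// ltW. Qed.

Lemma radius_ge0 : 0 <= error_radius.
Proof.
rewrite mulr_ge0 ?divr_ge0 ?mulr_ge0 ?(ltW rho0) ?(ltW beta_gt0)//.
by rewrite subr_ge0 -[leRHS]sqrtr1 ler_wsqrtr// gerBl tau_ge0.
Qed.

Lemma rho_radius_ge0 : 0 <= rho * error_radius.
Proof. exact: mulr_ge0 (ltW rho0) radius_ge0. Qed.

Lemma radius_root : rho * error_radius ^+ 2 + eps = beta * error_radius.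
Proof.
have := sqr_sqrtr (_ : 0 <= 1 - tau); rewrite subr_ge0 => /(_ tau_le1).
rewrite /error_radius; set s := Num.sqrt _ => s2.
(* Expressing [eps] through [s] turns the claim into a polynomial identity in [s];
   [s ^+ 2 = 1 - tau] is where [tau <= 1] enters. *)
have -> : eps = beta ^+ 2 / (4 * rho) * (1 - s ^+ 2).
  by rewrite s2 /tau; field; rewrite (gt_eqF rho0) (gt_eqF beta_gt0).
by field; rewrite (gt_eqF rho0).
Qed.

Lemma radius_le_half : rho * error_radius <= beta / 2.
Proof.
rewrite /error_radius (_ : rho * _ = beta / 2 * (1 - Num.sqrt (1 - tau))); last first.
  by field; rewrite (gt_eqF rho0).
by rewrite ler_piMr ?divr_ge0 ?(ltW beta_gt0)// gerBl sqrtr_ge0.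
Qed.

(** In [radius_root] the quadratic term is at most half of the right-hand side and is absorbed by
    it. *)
Lemma radius_le_residual_norm : beta * error_radius <= 2 * eps.
Proof.
have /eqP := radius_root; rewrite eq_sym -subr_eq => /eqP E.
have := ler_wpM2r radius_ge0 radius_le_half.
rewrite expr2 in E; lra.
Qed.

(** Both residuals vanish, so the derivative applied to the difference is the linearization error
    alone; for the size [n] of the difference this gives [beta * n <= beta / 2 * n]. *)
Lemma solution_unique U1 U2 : S U1 -> S U2 ->
  nrm (U1 - U0) <= error_radius -> nrm (U2 - U0) <= error_radius ->
  (forall v, S v -> res U1 v = 0) -> (forall v, S v -> res U2 v = 0) ->
  nrm (U2 - U1) = 0.
Proof.
move=> S1 S2 n1 n2 z1 z2; have S21 : S (U2 - U1) by exact: subspaceB.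
have n0 := snrm_ge0 snrm (U2 - U1).
have : beta * nrm (U2 - U1) <= rho * error_radius * nrm (U2 - U1).
  apply: infsup_le => // [|v Sv]; first by rewrite mulr_ge0// rho_radius_ge0.
  have := linearization_error S1 S2 Sv n1 n2.
  by rewrite z1// z2// subr0 sub0r normrN.
move=> H; apply/eqP; rewrite eq_le n0 andbT -(pmulr_rle0 _ beta_gt0).
have := ler_wpM2r n0 radius_le_half.
by move: H; lra.
Qed.

Lemma effectivity U : S U -> nrm (U - U0) <= error_radius ->
  (forall v, S v -> res U v = 0) ->
  error_radius <= (2 * gamma / beta + tau) * nrm (U - U0).
Proof.
move=> SU rU zU.
have SE : S (U - U0) by exact: subspaceB.
set n := nrm (U - U0) in rU *.
have n0 : 0 <= n by exact: (snrm_ge0 snrm).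
have epsle : eps <= gamma * n + rho * n ^+ 2.
  apply: ge_sup.
    by have [v nv] := nonnull_neq0; exists (res U0 v / nrm v), v.
  move=> _ [v nv <-]; rewrite ler_pdivrMr ?nonnull_gt0//.
  have [Sv _] := nv.
  (* Taking the actual error [n] as radius, instead of [error_radius], makes the remainder quadratic
     in [n]. *)
  have := linearization_error (r := n) SU0 SU Sv.
  rewrite subrr (snrm0 SS snrm) => /(_ n0 (lexx _)).
  rewrite zU// sub0r -opprD normrN ler_norml => /andP[_ H].
  have := dres_le_supsup Sv SE; rewrite ler_norml => /andP[H' _].
  rewrite -/n in H H'.
  have -> : (gamma * n + rho * n ^+ 2) * nrm v =
     gamma * nrm v * n + rho * n * n * nrm v by ring.
  by lra.
rewrite -(ler_pM2l beta_gt0) (le_trans radius_le_residual_norm)//.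
have -> : beta * ((2 * gamma / beta + tau) * n) =
    2 * gamma * n + 2 * rho * n * (2 * eps / beta).
  by rewrite /tau; field; rewrite gt_eqF.
(* One factor [n] is at most [error_radius], hence at most [2 * eps / beta]; this is the origin of
   the [tau] term. *)
have : rho * n * n <= rho * n * (2 * eps / beta).
  rewrite ler_wpM2l ?mulr_ge0 ?(ltW rho0)// ler_pdivlMr// mulrC.
  by rewrite (le_trans _ radius_le_residual_norm)// ler_wpM2l// ltW.
by rewrite expr2 in epsle; lra.
Qed.

Lemma solution_exists : exists U,
  [/\ S U, nrm (U - U0) <= error_radius & forall v, S v -> res U v = 0].
Proof.
have [n [e be]] := basis_exists SS snrm fS; have [eS egen einj] := be.
have [a a0 ac] := comb_lower_bound SS snrm be.
have Sc c : S (comb e c) by exact: subspace_comb.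
pose Uc c := U0 + comb e c.
have SUc c : S (Uc c) by exact: subspaceD.
have Uc0 c : Uc c - U0 = comb e c by rewrite /Uc addrC addKr.
have UcB c c' : Uc c - Uc c' = comb e (c - c').
  by rewrite /Uc opprD addrACA subrr add0r combB.
(* Coordinates are row vectors: [c *m M] lists the derivative in the direction [comb e c] tested
   against the basis. *)
pose M : 'M[R]_n := \matrix_(j, i) dres U0 (e i) (e j).
have ME c i : (c *m M) 0 i = dres U0 (e i) (comb e c).
  rewrite mxE (lin_comb SS (dres_linr (eS i)))//.
  by apply: eq_bigr => j _; rewrite mxE.
pose rv c : 'rV[R]_n := \row_i res (Uc c) (e i).
have lin_eq L L' : linear_on S L -> linear_on S L' ->
    (forall v, S v -> nrm v = 0 -> L v = 0) ->
    (forall v, S v -> nrm v = 0 -> L' v = 0) ->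
    (forall i, L (e i) = L' (e i)) -> forall v, S v -> L v = L' v.
  move=> l l' z z' E v Sv; have [c vc] := egen v Sv.
  rewrite (null_lin_eq SS be l z Sv vc) (null_lin_eq SS be l' z' Sv vc).
  by rewrite !(lin_comb SS)//; apply: eq_bigr => i _; rewrite E.
(* A direction annihilated by all tests is null by inf-sup, so its coordinates vanish; for a square
   matrix injectivity suffices. *)
have Munit : M \in unitmx.
  rewrite -row_free_unit; apply: inj_row_free => c cM0; apply: einj.
  apply/eqP; rewrite eq_le (snrm_ge0 snrm) andbT -(pmulr_rle0 _ beta_gt0).
  apply: infsup_le => // v Sv; rewrite mul0r normr_le0; apply/eqP.
  apply: (lin_eq (fun v => dres U0 v (comb e c)) (fun=> 0)) => //.
  - exact: dres_linl.
  - by move=> b u w _ _; rewrite mulr0 addr0.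
  - by move=> w Sw; exact: dres_nulll.
  by move=> i; rewrite -ME cM0 mxE.
(* Newton's map with the derivative frozen at [U0]. *)
pose g c := c - rv c *m invmx M.
pose A : set 'rV[R]_n := [set c | nrm (comb e c) <= error_radius].
have A_ c : A c -> nrm (Uc c - U0) <= error_radius by rewrite Uc0.
(* The linear equation solved by [g c], extended from basis tests to all of [S]; it replaces the
   inverse matrix in the estimates. *)
have gE c v : S v -> dres U0 v (comb e (g c)) =
    dres U0 v (comb e c) - res (Uc c) v.
  apply: (lin_eq (fun v => dres U0 v (comb e (g c)))
    (fun v => dres U0 v (comb e c) - res (Uc c) v)).
  - exact: dres_linl.
  - by move=> b u w Su Sw; rewrite dres_linl// res_lin//; ring.
  - by move=> w Sw; exact: dres_nulll.
  - by move=> w Sw w0; rewrite dres_nulll// res_null// subr0.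
  by move=> i; rewrite -!ME /g mulmxBl mulmxKV// !mxE.
have g_contr c c' : A c -> A c' ->
    nrm (comb e (g c - g c')) <= 2^-1 * nrm (comb e (c - c')).
  move=> Ac Ac'.
  rewrite -(ler_pM2l beta_gt0).
  apply: (@le_trans _ _ (rho * error_radius * nrm (comb e (c - c')))); last first.
    rewrite [leRHS]mulrA ler_wpM2r ?(snrm_ge0 snrm)//; exact: radius_le_half.
  apply: infsup_le => //.
    by rewrite mulr_ge0 ?(snrm_ge0 snrm)// rho_radius_ge0.
  move=> v Sv; rewrite combB (linB SS (dres_linr Sv))// !gE//.
  have := linearization_error (SUc c') (SUc c) Sv (A_ _ Ac') (A_ _ Ac).
  rewrite UcB -normrN => H; apply: le_trans H.
  rewrite combB (linB SS (dres_linr Sv))// le_eqVlt; apply/orP; left; apply/eqP.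
  by congr `| _ |; ring.
have gA c : A c -> A (g c).
  (* The target [beta * error_radius] is split into the linearization error over the ball and the
     residual at [U0]. *)
  move=> Ac; rewrite /A/= -(ler_pM2l beta_gt0) -radius_root.
  apply: infsup_le => //.
    by rewrite addr_ge0 ?residual_norm_ge0// mulr_ge0 ?sqr_ge0 ?(ltW rho0)//.
  move=> v Sv; rewrite gE//.
  have U00 : nrm (U0 - U0) <= error_radius by rewrite subrr (snrm0 SS snrm) radius_ge0.
  have := linearization_error SU0 (SUc c) Sv U00 (A_ _ Ac); rewrite Uc0 => H.
  rewrite (_ : _ - _ = - (res (Uc c) v - res U0 v - dres U0 v (comb e c)) - res U0 v);
    last by ring.
  rewrite (le_trans (ler_normD _ _))// !normrN mulrDl lerD//.
    rewrite (le_trans H)// ler_wpM2r ?(snrm_ge0 snrm)// expr2 [leRHS]mulrA.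
    by rewrite ler_wpM2l// rho_radius_ge0.
  exact: res_le_residual_norm.
have cA : compact A.
  apply: bounded_closed_compact.
    exists (a^-1 * error_radius); split; first exact: num_real.
    move=> x xr c Ac; apply: (le_trans _ (ltW xr)); rewrite ler_pdivlMl//.
    exact: le_trans (ac c) Ac.
  have -> : A = (fun c => nrm (comb e c)) @^-1` [set x | x <= error_radius] by [].
  apply: closed_comp; last exact: closed_le.
  move=> x _; apply: (continuous_subspace_setT _).2.
  exact: (continuous_snrm_comb SS snrm be).
(* The fixed point of the contraction [g] is found as a minimizer of its
   displacement, so that no completeness argument is needed. *)
pose f c := nrm (comb e (g c - c)).
have [||c0] := @EVT_min_rV R n f A _ cA.
- exists 0; rewrite /A/= (_ : comb e 0 = 0) ?(snrm0 SS snrm) ?radius_ge0//.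
  by rewrite /comb big1// => i _; rewrite mxE scale0r.
(* The factor 3/2 is 1/2 from the contraction plus 1 from the identity; the sum bounds the seminorm
   by the coordinate norm. *)
- apply: (lipschitz_within_continuous (C := 3 / 2 * \sum_i nrm (e i))).
  move=> c c' Ac Ac'; rewrite /f.
  rewrite (le_trans (snrm_dist SS snrm _ _))// -combB.
  rewrite (_ : _ - _ = (g c - g c') - (c - c')); last first.
    by rewrite [- (g c' - c')]opprB [c' - _]addrC [LHS]addrACA [- (c - c')]opprB [c' - c]addrC.
  rewrite combB (le_trans (snrmB SS snrm _ _))//.
  have := g_contr _ _ Ac Ac'.
  have := snrm_comb_le SS snrm (c - c') eS.
  by lra.
rewrite inE => Ac0 c0min.
(* The displacement of [g c0] is at most half that of [c0] and, by minimality, at least that of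
   [c0]; hence it is 0. *)
have gc0 : g c0 = c0.
  apply/eqP; rewrite -subr_eq0; apply/eqP/einj/eqP.
  rewrite eq_le (snrm_ge0 snrm) andbT -/(f c0).
  have := c0min (g c0); rewrite inE => /(_ (gA _ Ac0)).
  have := g_contr _ _ (gA _ Ac0) Ac0; rewrite -/(f c0) -/(f (g c0)).
  by lra.
exists (Uc c0); split => //; first exact: A_.
have rv0 : rv c0 = 0.
  have /eqP := gc0; rewrite /g -[X in _ == X]subr0 (inj_eq (addrI _)) eqr_opp.
  move=> /eqP/(congr1 (mulmx^~ M)) /=; rewrite mul0mx => <-.
  by rewrite mulmxKV.
apply: (lin_eq _ (fun=> 0)) => //.
- exact: res_lin.
- by move=> b u w _ _; rewrite mulr0 addr0.
- by move=> w Sw; exact: res_null.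
by move=> i; have /rowP/(_ i) := rv0; rewrite !mxE.
Qed.

End brezzi_rappaz_raviart.

(** * Integrability of products *)

Section integration.
Context d (T : measurableType d) (R : realType) (mu : {measure set T -> \bar R}).
Context (D : set T).
Hypothesis mD : measurable D.
Implicit Types f g h : T -> R.

Definition integ (f : T -> R) := mu.-integrable D (EFin \o f).

(* [L2 Om] is convertible to [sqint (lebesgue_rV R d) Om]. *)
Definition sqint (f : T -> R) :=
  measurable_fun D f /\ mu.-integrable D (EFin \o (fun x => f x ^+ 2)).

(** The class containing finite element functions and their gradients: multiplying by them preserves
    [integ] and [sqint], which makes room for a merely square-integrable lift. *)
Definition aebd (f : T -> R) :=
  measurable_fun D f /\ exists C, {ae mu, forall x, D x -> `|f x| <= C}.

Lemma integ_measurable f : integ f -> measurable_fun D f.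
Proof. by move=> /(measurable_int mu) /measurable_EFinP. Qed.

Lemma integ_eq f g : {in D, f =1 g} -> integ f -> integ g.
Proof. by move=> fg; apply: eq_integrable => // x /fg /= ->. Qed.

Lemma integ_le f g : measurable_fun D f -> (forall x, D x -> `|f x| <= `|g x|) ->
  integ g -> integ f.
Proof.
move=> mf fg; apply: le_integrable => //; first exact/measurable_EFinP.
Qed.

Lemma integ0 : integ (fun=> 0).
Proof. exact: integrable0. Qed.

Lemma integD f g : integ f -> integ g -> integ (fun x => f x + g x).
Proof. exact: integrableD. Qed.

Lemma integB f g : integ f -> integ g -> integ (fun x => f x - g x).
Proof. exact: integrableB. Qed.

Lemma integZ a f : integ f -> integ (fun x => a * f x).
Proof. exact: integrableZl. Qed.

Lemma integ_norm f : integ f -> integ (fun x => `|f x|).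
Proof. exact: integrable_abse. Qed.

Lemma integ_sum (I : Type) (s : seq I) (f : I -> T -> R) :
  (forall i, integ (f i)) -> integ (fun x => \sum_(i <- s) f i x).
Proof.
move=> fi; elim: s => [|i s IH].
  by under eq_fun do rewrite big_nil; exact: integ0.
by under eq_fun do rewrite big_cons; exact: integD.
Qed.

Lemma Rintegral_lin a f g h : integ g -> integ h ->
  (forall x, D x -> f x = a * g x + h x) ->
  \int[mu]_(x in D) f x = a * \int[mu]_(x in D) g x + \int[mu]_(x in D) h x.
Proof.
move=> ig ih fE; rewrite -RintegralZl// -RintegralD//; last exact: integZ.
by apply: eq_Rintegral => x; rewrite inE; exact: fE.
Qed.

Lemma Rintegral_sum (I : Type) (s : seq I) (f : I -> T -> R) :
  (forall i, integ (f i)) ->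
  \int[mu]_(x in D) (\sum_(i <- s) f i x) = \sum_(i <- s) \int[mu]_(x in D) f i x.
Proof.
move=> fi; elim: s => [|i s IH].
  rewrite big_nil; under eq_Rintegral do rewrite big_nil.
  by rewrite Rintegral_cst// mul0r.
rewrite big_cons -IH; under eq_Rintegral do rewrite big_cons.
rewrite RintegralD//; [exact: fi|exact: integ_sum].
Qed.

Lemma ae_Rintegral_eq0 f : integ f -> {ae mu, forall x, D x -> f x = 0} ->
  \int[mu]_(x in D) f x = 0.
Proof.
move=> /(measurable_int mu) mf f0; rewrite /Rintegral.
rewrite (ae_eq_integral (cst 0%E)) ?integral0//.
by apply: filterS f0 => x /= fx /fx ->.
Qed.

Lemma Rintegral_eq0_ae f : integ f -> (forall x, 0 <= f x) ->
  \int[mu]_(x in D) f x = 0 -> {ae mu, forall x, D x -> f x = 0}.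
Proof.
move=> fi f0 If0.
have : (\int[mu]_(x in D) `|(EFin \o f) x| = 0)%E.
  rewrite (eq_integral (fun x => (f x)%:E)) => [|x _]; last by rewrite /= ger0_norm.
  by rewrite -[LHS]fineK ?[fine _]If0//; exact: integrable_fin_num.
move=> /(ae_eq_integral_abs _ mD (measurable_int mu fi)).1.
by apply: filterS => x /= fx /fx [].
Qed.

Lemma norm_Rintegral_le f g : integ f -> integ g ->
  (forall x, D x -> `|f x| <= g x) ->
  `|\int[mu]_(x in D) f x| <= \int[mu]_(x in D) g x.
Proof.
move=> fi gi fg; rewrite (le_trans (le_normr_Rintegral _ _))//.
by apply: le_Rintegral => //; exact: integ_norm.
Qed.

Lemma sqint_measurable f : sqint f -> measurable_fun D f. Proof. by case. Qed.

Lemma sqint_le f g : measurable_fun D f -> (forall x, D x -> `|f x| <= `|g x|) ->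
  sqint g -> sqint f.
Proof.
move=> mf fg [mg ig]; split => //; apply: integ_le ig.
  exact: measurable_funX.
by move=> x Dx; rewrite !normrX lerXn2r ?nnegrE// fg.
Qed.

Lemma sqintM f g : sqint f -> sqint g -> integ (fun x => f x * g x).
Proof.
move=> [mf fi] [mg gi]; apply: integ_le (integD fi gi).
  exact: measurable_funM.
move=> x _; rewrite [leRHS]ger0_norm ?addr_ge0 ?sqr_ge0//.
rewrite normrM -[X in _ <= X + _]real_normK ?num_real//.
rewrite -[X in _ <= _ + X]real_normK ?num_real//.
have := sqr_ge0 (`|f x| - `|g x|); rewrite sqrrB.
have := sqr_ge0 `|f x|; have := sqr_ge0 `|g x|; rewrite !expr2; lra.
Qed.

Lemma sqintD f g : sqint f -> sqint g -> sqint (fun x => f x + g x).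
Proof.
move=> sf sg; have [mf fi] := sf; have [mg gi] := sg.
split; first exact: measurable_funD.
apply: integ_eq (integD (integD fi gi) (integZ 2 (sqintM sf sg))) => x _ /=.
by rewrite sqrrD; ring.
Qed.

Lemma sqint0 : sqint (fun=> 0).
Proof.
by split => //; apply: integ_eq integ0 => x _; rewrite expr0n.
Qed.

Lemma sqint_sum (I : Type) (s : seq I) (f : I -> T -> R) :
  (forall i, sqint (f i)) -> sqint (fun x => \sum_(i <- s) f i x).
Proof.
move=> fi; elim: s => [|i s IH].
  by under eq_fun do rewrite big_nil; exact: sqint0.
by under eq_fun do rewrite big_cons; exact: sqintD.
Qed.

(** The bound on [g] holds only almost everywhere, so the pointwise domination of [integ_le] is
    replaced by an a.e. comparison of integrals of absolute values. *)
Lemma integ_aebd f g : integ f -> aebd g -> integ (fun x => f x * g x).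
Proof.
move=> fi [mg [C gC]]; have mf := integ_measurable fi.
have mfg : measurable_fun D (fun x => f x * g x) by exact: measurable_funM.
apply/integrableP; split; first exact/measurable_EFinP.
have /integrableP[_] := integ_norm (integZ C fi).
apply: le_lt_trans; apply: ae_ge0_le_integral => //.
- by apply: measurableT_comp => //; exact/measurable_EFinP.
- apply: measurableT_comp => //; apply/measurable_EFinP/measurableT_comp => //.
  exact: measurable_funM.
apply: filterS gC => x gx Dx /=; rewrite lee_fin normr_id !normrM mulrC.
by rewrite ler_wpM2r// (le_trans (gx Dx))// ler_norm.
Qed.

Lemma aebdZ a f : aebd f -> aebd (fun x => a * f x).
Proof.
move=> [mf [C fC]]; split; first exact: measurable_funM.
exists (`|a| * C); apply: filterS fC => x fx Dx.
by rewrite normrM ler_wpM2l// fx.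
Qed.

Lemma aebdD f g : aebd f -> aebd g -> aebd (fun x => f x + g x).
Proof.
move=> [mf [C fC]] [mg [C' gC]]; split; first exact: measurable_funD.
exists (C + C'); apply: filterS2 fC gC => x fx gx Dx.
by rewrite (le_trans (ler_normD _ _))// lerD ?fx ?gx.
Qed.

Lemma aebdM f g : aebd f -> aebd g -> aebd (fun x => f x * g x).
Proof.
move=> [mf [C fC]] [mg [C' gC]]; split; first exact: measurable_funM.
exists (C * C'); apply: filterS2 fC gC => x fx gx Dx.
by rewrite normrM ler_pM ?fx ?gx.
Qed.

Lemma sqint_aebd f g : sqint f -> aebd g -> sqint (fun x => f x * g x).
Proof.
move=> [mf fi] bg; have [mg _] := bg; split; first exact: measurable_funM.
apply: integ_eq (integ_aebd fi (aebdM bg bg)) => x _ /=.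
by rewrite -expr2 exprMn.
Qed.

Lemma aebd_sqint f : (mu D < +oo)%E -> aebd f -> sqint f.
Proof.
move=> Dfin bf; split; first by case: bf.
have i1 : integ (fun=> 1).
  apply/integrableP; split; first exact/measurable_EFinP.
  by under eq_integral do rewrite /= normr1; rewrite integral_cst// mul1e.
by apply: integ_eq (integ_aebd i1 (aebdM bf bf)) => x _; rewrite mul1r expr2.
Qed.

Definition mx_sqint m n (G : T -> 'M[R]_(m, n)) := forall i j, sqint (fun x => G x i j).

Definition mx_aebd m n (G : T -> 'M[R]_(m, n)) := forall i j, aebd (fun x => G x i j).

Lemma dot_integ n (u v : T -> 'rV[R]_n) : mx_sqint u -> mx_sqint v ->
  integ (fun x => dot (u x) (v x)).
Proof. by move=> su sv; apply: integ_sum => i; exact: sqintM. Qed.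

Lemma ddot_integ n (G H : T -> 'M[R]_n) : mx_sqint G -> mx_sqint H ->
  integ (fun x => ddot (G x) (H x)).
Proof. by move=> sG sH; do 2 apply: integ_sum => ?; exact: sqintM. Qed.

Lemma ddot_sqint n (G H : T -> 'M[R]_n) : mx_sqint G -> mx_aebd H ->
  sqint (fun x => ddot (G x) (H x)).
Proof. by move=> sG sH; do 2 apply: sqint_sum => ?; exact: sqint_aebd. Qed.

(** Integrability of convection: field times gradient is only integrable, so the test field has to
    be essentially bounded. *)
Lemma dot_mul_integ n (u v : T -> 'rV[R]_n) (G : T -> 'M[R]_n) :
  mx_sqint u -> mx_sqint G -> mx_aebd v ->
  integ (fun x => dot (u x *m G x) (v x)).
Proof.
move=> su sG bv; apply: integ_sum => i; apply: integ_aebd => //.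
by under eq_fun do rewrite mxE; apply: integ_sum => j; exact: sqintM.
Qed.

Lemma tr_sqint n (G : T -> 'M[R]_n) : mx_sqint G -> sqint (fun x => \tr (G x)).
Proof. by move=> sG; exact: sqint_sum. Qed.

End integration.

(** * Meshes and the Frobenius norm *)

Section geometry.
Context (R : realType) (d : nat).
Implicit Types (Om : set 'rV[R]_d) (K : cell R d).

Lemma open_rV_measurable Om : open Om -> measurable Om.
Proof. by move=> oOm; exact: sub_sigma_algebra. Qed.

Lemma bounded_set_coord Om : bounded_set Om ->
  exists M, forall x, Om x -> forall i, `|x 0 i| <= M.
Proof.
move=> [M [_ bM]]; exists (M + 1) => x Ox i.
rewrite (le_trans (ler_coord_norm _ _))//; apply: bM => //.
by rewrite ltrDl.
Qed.

Lemma bounded_set_measure_lty Om : measurable Om -> bounded_set Om ->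
  (lebesgue_rV R d Om < +oo)%E.
Proof.
move=> mOm /bounded_set_coord[M OmM].
pose B (i : 'I_d) : set R := [set` `[- M, M]].
have mB i : measurable (B i) by exact: measurable_itv.
have mbox : measurable [set x : 'rV[R]_d | forall i, B i (x ord0 i)].
  rewrite (_ : mkset _ =
    \bigcap_(i in [set: 'I_d]) [set x : 'rV[R]_d | B i (x 0 i)]).
    by apply: fin_bigcap_measurable => // i _; exact: measurable_coord.
  by apply/seteqP; split => x H i => [_|]; exact: H.
apply: (@le_lt_trans _ _ (lebesgue_rV R d [set x | forall i, B i (x ord0 i)])).
  apply: le_measure; rewrite ?inE//.
  by move=> x Ox i; rewrite /B /= in_itv/= -ler_norml OmM.
rewrite lebesgue_rV_box// ltey_eq; apply/orP; left.
apply: (big_ind (fun x : \bar R => x \is a fin_num)) => // [x y|i _].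
  exact: fin_numM.
by rewrite lebesgue_measure_itv/=; case: ifPn.
Qed.

Lemma reference_cell_compact cube : compact (@reference_cell R d cube).
Proof.
have clge i : closed [set x : 'rV[R]_d | 0 <= x 0 i].
  apply: (@closed_comp _ _ (fun x : 'rV[R]_d => x 0 i) [set r | 0 <= r]).
    by move=> x _; exact: coord_continuous.
  exact: closed_ge.
have clle i : closed [set x : 'rV[R]_d | x 0 i <= 1].
  apply: (@closed_comp _ _ (fun x : 'rV[R]_d => x 0 i) [set r | r <= 1]).
    by move=> x _; exact: coord_continuous.
  exact: closed_le.
have bd (A : set 'rV[R]_d) : (forall x, A x -> forall i, 0 <= x 0 i <= 1) ->
    bounded_set A.
  move=> A01; exists 1; split => // M M1 x /A01 x01.
  apply: le_trans (ltW M1); rewrite [leLHS]/Num.norm/= mx_normrE.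
  apply: bigmax_le => //= -[i j] _ /=; rewrite ord1.
  by have /andP[x0 x1] := x01 j; rewrite ger0_norm.
apply: bounded_closed_compact; case: cube.
- exact: bd.
- apply: bd => x [x0 x1] i; rewrite x0/= (le_trans _ x1)//.
  by rewrite (bigD1 i)//= lerDl sumr_ge0.
- rewrite (_ : reference_cell true =
    (\bigcap_i [set x : 'rV[R]_d | 0 <= x 0 i]) `&`
    (\bigcap_i [set x : 'rV[R]_d | x 0 i <= 1])).
    by apply: closedI; apply: closed_bigI => i _.
  apply/seteqP; split => x /=; last by move=> [x0 x1] i; rewrite x0// x1.
  by move=> x01; split => i _ /=; have /andP[] := x01 i.
- rewrite (_ : reference_cell false =
    (\bigcap_i [set x : 'rV[R]_d | 0 <= x 0 i]) `&`
    [set x : 'rV[R]_d | \sum_i x 0 i <= 1]).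
    apply: closedI; first by apply: closed_bigI => i _.
    apply: (@closed_comp _ _ (fun x : 'rV[R]_d => \sum_i x 0 i) [set r | r <= 1]).
      move=> x _; elim: (index_enum _) => [|i s IH].
        by under eq_fun do rewrite big_nil; exact: cst_continuous.
      under eq_fun do rewrite big_cons; apply: continuousD => //.
      exact: coord_continuous.
    exact: closed_le.
  by apply/seteqP; split => x /= -[x0 x1]; split => // i; [move=> _|]; exact: x0.
Qed.

(** The affine image of a compact reference cell is compact, hence closed, hence Borel. *)
Lemma cell_set_measurable K : measurable (cell_set K).
Proof.
have : compact (cell_set K).
  apply: continuous_compact; last exact: reference_cell_compact.
  apply: (lipschitz_within_continuous
    (C := \sum_i `|row i (cell_mx K)|)) => x y _ _.
  have -> : x *m cell_mx K + cell_org K - (y *m cell_mx K + cell_org K) =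
      comb (fun i => row i (cell_mx K)) (x - y).
    by rewrite opprD addrACA subrr addr0 -mulmxBl mulmx_sum_row.
  apply: (@snrm_comb_le _ _ setT) => //.
  by split => // [a v _|u v _ _]; [exact: normrZ|exact: ler_normD].
move=> /(compact_closed (@norm_hausdorff _ _)).
rewrite -[cell_set K]setCK closedC => /open_rV_measurable.
by move=> /measurableC.
Qed.

Lemma meval_bounded (P : mpoly.mpoly d R) M : exists C, forall v : 'I_d -> R,
  (forall i, `|v i| <= M) -> `|mpoly.meval v P| <= C.
Proof.
exists (\sum_(m <- mpoly.msupp P) `|mpoly.mcoeff m P| *
  \prod_i M ^+ mpoly.fun_of_multinom m i) => v vM.
rewrite mpoly.mevalE (le_trans (ler_norm_sum _ _ _))// ler_sum// => m _.
rewrite normrM ler_wpM2l// normr_prod ler_prod// => i _.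
by rewrite normr_ge0/= normrX lerXn2r ?nnegrE// (le_trans _ (vM i)).
Qed.

End geometry.

(** * Frobenius inner product and first-order expansion of [|G| G] *)

Section frobenius.
Context (R : realType) (d : nat).
Implicit Types (u v w : 'rV[R]_d) (A B G H : 'M[R]_d).

Lemma dotPl a u v w : dot (a *: u + v) w = a * dot u w + dot v w.
Proof.
rewrite /dot mulr_sumr -big_split/=; apply: eq_bigr => i _.
by rewrite !mxE; ring.
Qed.

Lemma dotC u v : dot u v = dot v u.
Proof. by apply: eq_bigr => i _; rewrite mulrC. Qed.

Lemma dotPr a u v w : dot w (a *: u + v) = a * dot w u + dot w v.
Proof. by rewrite !(dotC w) dotPl. Qed.

Lemma dot_ge0 u : 0 <= dot u u.
Proof. by apply: sumr_ge0 => i _; rewrite -expr2 sqr_ge0. Qed.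

Lemma dot0l u : dot 0 u = 0.
Proof. by rewrite /dot big1// => i _; rewrite mxE mul0r. Qed.

Lemma dot0r u : dot u 0 = 0. Proof. by rewrite dotC dot0l. Qed.

Lemma dot_eq0 u : dot u u = 0 -> u = 0.
Proof.
move=> /eqP; rewrite psumr_eq0 => [|i _]; last by rewrite -expr2 sqr_ge0.
move=> /allP u0; apply/rowP => i; rewrite mxE; apply/eqP.
by have := u0 i (mem_index_enum _); rewrite mulf_eq0 orbb.
Qed.

Lemma ddotPl a A B G : ddot (a *: A + B) G = a * ddot A G + ddot B G.
Proof.
rewrite /ddot mulr_sumr -big_split/=; apply: eq_bigr => i _.
rewrite mulr_sumr -big_split/=; apply: eq_bigr => j _.
by rewrite !mxE; ring.
Qed.

Lemma ddotC A B : ddot A B = ddot B A.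
Proof. by do 2 apply: eq_bigr => ? _; rewrite mulrC. Qed.

Lemma ddotPr a A B G : ddot G (a *: A + B) = a * ddot G A + ddot G B.
Proof. by rewrite !(ddotC G) ddotPl. Qed.

Lemma ddot_ge0 A : 0 <= ddot A A.
Proof. by do 2 apply: sumr_ge0 => ? _; rewrite -expr2 sqr_ge0. Qed.

Lemma ddot0l A : ddot 0 A = 0.
Proof. by rewrite /ddot big1// => i _; rewrite big1// => j _; rewrite mxE mul0r. Qed.

Lemma ddot0r A : ddot A 0 = 0. Proof. by rewrite ddotC ddot0l. Qed.

Lemma ddot_eq0 A : ddot A A = 0 -> A = 0.
Proof.
move=> /eqP; rewrite psumr_eq0 => [|i _]; last first.
  by apply: sumr_ge0 => j _; rewrite -expr2 sqr_ge0.
move=> /allP A0; apply/matrixP => i j; rewrite mxE; apply/eqP.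
have := A0 i (mem_index_enum _); rewrite psumr_eq0 => [|k _]; last first.
  by rewrite -expr2 sqr_ge0.
by move=> /allP/(_ j (mem_index_enum _)); rewrite mulf_eq0 orbb.
Qed.

Let setT_subspace : subspace_set [set: 'M[R]_d]. Proof. by []. Qed.

Let ddot_lin B : setT B -> linear_on [set: 'M[R]_d] (@ddot R d ^~ B).
Proof. by move=> _ a A G _ _; exact: ddotPl. Qed.

Lemma ddot_cauchy_schwarz A B : `|ddot A B| <= fnorm A * fnorm B.
Proof. exact: (psd_norm_cauchy_schwarz setT_subspace ddot_lin ddotC ddot_ge0). Qed.

Lemma fnorm_ge0 A : 0 <= fnorm A. Proof. exact: sqrtr_ge0. Qed.

Lemma fnorm_sqr A : fnorm A ^+ 2 = ddot A A.
Proof. by rewrite sqr_sqrtr// ddot_ge0. Qed.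

Lemma fnorm_dist A B : `|fnorm (A + B) - fnorm A| <= fnorm B.
Proof.
have sT := psd_seminorm setT_subspace ddot_lin ddotC ddot_ge0.
have := @snrm_dist _ _ _ setT_subspace _ sT (A + B) A.
by rewrite addrAC subrr add0r; apply.
Qed.

(* [|G + H|] is compared with its first-order expansion by Cauchy-Schwarz from
   below and by AM-GM, [2 |G| |G + H| <= |G|^2 + |G + H|^2], from above. *)
Lemma fnorm_expansion G H :
  `|fnorm G * (fnorm (G + H) - fnorm G) - ddot G H| <= ddot H H / 2.
Proof.
set a := fnorm (G + H); set g := fnorm G.
have a2 : a ^+ 2 = g ^+ 2 + 2 * ddot G H + ddot H H.
  rewrite /a /g !fnorm_sqr.
  have -> : G + H = 1 *: G + H by rewrite scale1r.
  rewrite ddotPl !ddotPr (ddotC H G); ring.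
have /ler_normlP[_] := ddot_cauchy_schwarz (G + H) G.
have -> : ddot (G + H) G = g ^+ 2 + ddot G H.
  by rewrite -[G in G + H]scale1r ddotPl /g fnorm_sqr mul1r (ddotC H).
rewrite -/a -/g => cs.
have := sqr_ge0 (a - g); rewrite sqrrB a2 => amgm.
have := ddot_ge0 H; rewrite !expr2 in cs amgm * => h0.
by rewrite ler_norml; apply/andP; split; lra.
Qed.

(** The error splits into [|G + sH| - |G|] times [s H : B], at most [s^2 |H|^2 |B|], and the
    first-order error of [|G + sH|] times [G : B], at most half of that; hence 3/2. Dividing
    [fnorm_expansion] by [|G|] is compensated by [|G : B| <= |G| |B|], so the bound does not
    degenerate near [G = 0], where the second piece vanishes. *)
Lemma fnorm_mul_expansion s G H B :
  `|fnorm (G + s *: H) * ddot (G + s *: H) B - fnorm G * ddot G B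
    - s * (fnorm G * ddot H B + ddot G H / fnorm G * ddot G B)|
  <= s ^+ 2 * (3 / 2 * (ddot H H * fnorm B)).
Proof.
have dsl A C : ddot A (s *: C) = s * ddot A C.
  by rewrite -[s *: C]addr0 ddotPr ddot0r addr0.
have dsr A C : ddot (s *: A) C = s * ddot A C by rewrite ddotC dsl ddotC.
have dD A C E : ddot (A + C) E = ddot A E + ddot C E.
  by rewrite -[A in LHS]scale1r ddotPl mul1r.
set a := fnorm (G + s *: H); set g := fnorm G.
have h0 := ddot_ge0 H; have b0 := fnorm_ge0 B; have g0 := fnorm_ge0 G.
have e1 : `|(a - g) * ddot (s *: H) B| <= s ^+ 2 * (ddot H H * fnorm B).
  rewrite normrM (_ : s ^+ 2 * _ = fnorm (s *: H) * (fnorm (s *: H) * fnorm B)).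
    by rewrite ler_pM ?normr_ge0 ?fnorm_dist ?ddot_cauchy_schwarz.
  by rewrite [RHS]mulrA -expr2 fnorm_sqr dsl dsr; ring.
have e2 : `|(a - g) * ddot G B - s * (ddot G H / g * ddot G B)| <=
    s ^+ 2 * (1 / 2 * (ddot H H * fnorm B)).
  have [gz|gn] := eqVneq g 0.
    have -> : G = 0 by apply: ddot_eq0; rewrite -fnorm_sqr -/g gz expr0n.
    rewrite !ddot0l !mulr0 subr0 normr0 mulr_ge0 ?sqr_ge0//.
    by rewrite mulr_ge0 ?divr_ge0// mulr_ge0.
  have gp : 0 < g by rewrite lt_neqAle eq_sym gn.
  have -> : (a - g) * ddot G B - s * (ddot G H / g * ddot G B) =
      (g * (a - g) - ddot G (s *: H)) * (ddot G B / g).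
    by rewrite dsl; field.
  have := fnorm_expansion G (s *: H); rewrite -/a -/g dsl dsr => exp.
  rewrite normrM (_ : _ * (1 / 2 * _) = s * (s * ddot H H) / 2 * fnorm B); last first.
    by field.
  rewrite ler_pM//; first by rewrite -(dsl H).
  rewrite normrM normfV (gtr0_norm gp) ler_pdivrMr// mulrC.
  exact: ddot_cauchy_schwarz.
have -> : a * ddot (G + s *: H) B - g * ddot G B
    - s * (g * ddot H B + ddot G H / g * ddot G B) =
  (a - g) * ddot (s *: H) B +
    ((a - g) * ddot G B - s * (ddot G H / g * ddot G B)).
  by rewrite dD dsr; ring.
rewrite (le_trans (ler_normD _ _))//.
by apply: le_trans (lerD e1 e2) _; rewrite -mulrDr; lra.
Qed.

End frobenius.

(** * Square integrability of Frobenius norms *)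

Section fnorm_integrability.
Context dd (T : measurableType dd) (R : realType) (mu : {measure set T -> \bar R}).
Context (D : set T) (mD : measurable D) (d : nat).

Lemma fnorm_sqint (G : T -> 'M[R]_d) : mx_sqint mu D G ->
  sqint mu D (fun x => fnorm (G x)).
Proof.
move=> sG; have iG := ddot_integ mD sG sG; split; last first.
  by apply: integ_eq iG => // x _; rewrite fnorm_sqr.
under eq_fun do rewrite /fnorm -powR12_sqrt ?ddot_ge0//.
apply: (@measurableT_comp _ _ _ _ _ _ (fun r : R => r `^ 2^-1)).
  exact: measurable_powR.
exact: integ_measurable iG.
Qed.

(** Cauchy-Schwarz dominates the quotient by [fnorm (H x)], also where [G x = 0] and the quotient is
    0 by convention. *)
Lemma ddot_div_fnorm_sqint (G H : T -> 'M[R]_d) :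
  mx_sqint mu D G -> mx_sqint mu D H ->
  sqint mu D (fun x => ddot (G x) (H x) / fnorm (G x)).
Proof.
move=> sG sH; apply: sqint_le (fnorm_sqint sH) => //.
  apply: measurable_funM; first exact: integ_measurable (ddot_integ mD sG sH).
  under eq_fun do rewrite -powR_inv1 ?fnorm_ge0//.
  apply: (@measurableT_comp _ _ _ _ _ _ (fun r : R => r `^ (-1))).
    exact: measurable_powR.
  exact: sqint_measurable (fnorm_sqint sG).
move=> x _; rewrite normrM normfV !(ger0_norm (fnorm_ge0 _)).
have [->|g0] := eqVneq (fnorm (G x)) 0; first by rewrite invr0 mulr0 fnorm_ge0.
rewrite ler_pdivrMr; last by rewrite lt_neqAle eq_sym g0 fnorm_ge0.
by rewrite mulrC ddot_cauchy_schwarz.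
Qed.

End fnorm_integrability.

(** * The Smagorinsky operator *)

Section operators.
Context (R : realType) (d : nat) (pb : problem R d).
Local Notation leb := (lebesgue_rV R d).
Local Notation Om := (Omega pb).
Local Notation state := (state R d).
Local Notation uD := (uD pb).
Hypothesis oOm : open Om.
Hypothesis bOm : bounded_set Om.
Hypothesis cells : closure Om = \bigcup_k cell_set (mesh pb k).
Hypothesis uD_H1 : inH1 Om uD.
Hypothesis force_L2 : forall j, L2 Om (fun x => force pb x 0 j).

Let mOm : measurable Om. Proof. exact: open_rV_measurable. Qed.

Let finOm : (leb Om < +oo)%E. Proof. exact: bounded_set_measure_lty. Qed.

Lemma mx_aebd_sqint m n (G : 'rV[R]_d -> 'M[R]_(m, n)) :
  mx_aebd leb Om G -> mx_sqint leb Om G.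
Proof. by move=> bG i j; exact: aebd_sqint. Qed.

(** Finitely many cells cover [Om]; the sum of the absolute values of the cell bounds dominates each
    of them. *)
Lemma piecewise_aebd (f : 'rV[R]_d -> R) : measurable_fun Om f ->
  (forall k : 'I_(ncell pb), exists C, {ae leb, forall x, KO k x -> `|f x| <= C}) ->
  aebd leb Om f.
Proof.
move=> mf /choice[C fC]; split => //; exists (\sum_k `|C k|).
have : {ae leb, forall x (k : 'I_(ncell pb)), KO k x -> `|f x| <= C k}.
  exact: filter_forall.
apply: filterS => x fx Ox.
have : closure Om x by exact: subset_closure.
rewrite cells => -[k _ Kx]; rewrite (le_trans (fx k _))//.
by rewrite (bigD1 k)//= (le_trans (ler_norm _))// lerDl sumr_ge0.
Qed.

Definition bounded_state (U : state) :=
  [/\ mx_aebd leb Om (fld U.1), mx_aebd leb Om (grad U.1) & aebd leb Om U.2].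

(** Polynomials and their derivatives are bounded on the bounded set [Om]. *)
Lemma fe_bounded_state (U : state) : inH1 Om U.1 -> fe_velocity pb U.1 ->
  L2 Om U.2 -> fe_pressure pb U.2 -> bounded_state U.
Proof.
move=> [L2u L2g _] feu [mp _] fep.
have [M OmM] := bounded_set_coord bOm.
have KOM (k : 'I_(ncell pb)) x : KO k x -> forall i, `|x 0 i| <= M by move=> [_ /OmM].
split.
- move=> i j; rewrite ord1; apply: piecewise_aebd; first by case: (L2u j).
  move=> k; have [P uP] := feu k; have [C PC] := meval_bounded (P j) M.
  exists C; apply: filterS uP => x + Kx => /(_ Kx)[-> _].
  by apply: PC; exact: KOM Kx.
- move=> i j; apply: piecewise_aebd; first by case: (L2g i j).
  move=> k; have [P uP] := feu k.
  have [C PC] := meval_bounded (mpoly.mderiv i (P j)) M.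
  exists C; apply: filterS uP => x + Kx => /(_ Kx)[_ ->].
  by apply: PC; exact: KOM Kx.
- apply: piecewise_aebd => // k; have [P uP] := fep k.
  have [C PC] := meval_bounded P M.
  exists C; apply: filterS uP => x + Kx => /(_ Kx) ->.
  by apply: PC; exact: KOM Kx.
Qed.

(** * Integrability and linearity of the forms on the discrete space *)

Context (S : set state).
Hypothesis SS : subspace_set S.
Hypothesis bS : forall U, S U -> bounded_state U.

Let fld_bd U : S U -> mx_aebd leb Om (fld U.1). Proof. by move=> /bS[]. Qed.
Let grad_bd U : S U -> mx_aebd leb Om (grad U.1). Proof. by move=> /bS[]. Qed.
Let prs_bd U : S U -> aebd leb Om U.2. Proof. by move=> /bS[]. Qed.
Let fld_L2 U : S U -> mx_sqint leb Om (fld U.1).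
Proof. by move=> /fld_bd; exact: mx_aebd_sqint. Qed.
Let grad_L2 U : S U -> mx_sqint leb Om (grad U.1).
Proof. by move=> /grad_bd; exact: mx_aebd_sqint. Qed.
Let prs_L2 U : S U -> sqint leb Om U.2.
Proof. by move=> /prs_bd; exact: aebd_sqint. Qed.
Let uD_L2 : mx_sqint leb Om (fld uD).
Proof. by move=> i j; rewrite ord1; case: uD_H1 => /(_ j). Qed.
Let guD_L2 : mx_sqint leb Om (grad uD).
Proof. by move=> i j; case: uD_H1 => _ /(_ i j). Qed.
Let f_L2 : mx_sqint leb Om (force pb).
Proof. by move=> i j; rewrite ord1; exact: force_L2. Qed.

Let gUD_L2 U : S U -> mx_sqint leb Om (grad (U.1 + uD)).
Proof.
move=> SU i j; have := sqintD mOm (grad_L2 SU i j) (guD_L2 i j).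
apply: sqint_le => // [|x _]; last by rewrite /grad/= mxE.
have [mU _] := grad_L2 SU i j; have [mD _] := guD_L2 i j.
by rewrite [X in measurable_fun _ X](_ : _ = (fun x => grad U.1 x i j + grad uD x i j));
  [exact: measurable_funD|apply/funext => x; rewrite mxE].
Qed.

(** The cellwise factor of [fnorm (grad w x)] in [nuT], gathered into one bounded function. *)
Definition viscosity_weight (x : 'rV[R]_d) : R :=
  \sum_k (CS pb * @h_ _ _ pb k) ^+ 2 * \1_(K_ k) x.

Local Notation om := viscosity_weight.

Lemma nuTE w x : nuT pb w x = om x * fnorm (grad w x).
Proof.
rewrite /nuT /viscosity_weight mulr_sumr mulr_suml; apply: eq_bigr => k _.
by rewrite exprMn; ring.
Qed.

Lemma om_ge0 x : 0 <= om x.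
Proof. by apply: sumr_ge0 => k _; rewrite mulr_ge0 ?sqr_ge0. Qed.

Lemma indic_K_aebd (k : 'I_(ncell pb)) : aebd leb Om (\1_(K_ k)).
Proof.
split; first by apply: measurable_indic; exact: cell_set_measurable.
exists 1; apply: aeW => x _; rewrite indicE.
by case: (_ \in _); rewrite ?normr1 ?normr0.
Qed.

Lemma om_aebd : aebd leb Om om.
Proof.
rewrite /viscosity_weight; elim: (index_enum _) => [|k s IH].
  under eq_fun do rewrite big_nil; split => //.
  by exists 0; apply: aeW => x _; rewrite normr0.
under eq_fun do rewrite big_cons; apply: aebdD => //.
exact/aebdZ/indic_K_aebd.
Qed.

(** Each cell integral is moved to [Om] by its indicator; points shared by several cells are counted
    alike on both sides. *)
Lemma Rintegral_KO (f : 'rV[R]_d -> R) : integ leb Om f ->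
  \sum_k \int[leb]_(x in @KO _ _ pb k) ((CS pb * @h_ _ _ pb k) ^+ 2 * f x) =
  \int[leb]_(x in Om) (om x * f x).
Proof.
move=> fi; rewrite /viscosity_weight.
under [RHS]eq_Rintegral do rewrite mulr_suml.
rewrite Rintegral_sum// => [|k]; last first.
  apply: integ_eq (integ_aebd mOm (integZ mOm ((CS pb * h_ k) ^+ 2) fi)
    (indic_K_aebd k)) => // x _.
  by ring.
apply: eq_bigr => k _; rewrite /KO Rintegral_mkcondl.
apply: eq_Rintegral => x _; rewrite patchE indicE.
by case: (_ \in _); rewrite ?mulr1// mulr0 mul0r.
Qed.

(* [normX] vanishes exactly on the a.e.-null states, so functionals on [S] have to
   be checked to factor through the quotient. *)
Definition lin_null (L : state -> R) := linear_on S L /\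
  forall v, S v -> ae_eq_state Om v 0 -> L v = 0.

Lemma lin_nullD L L' : lin_null L -> lin_null L' -> lin_null (fun v => L v + L' v).
Proof.
move=> [l n] [l' n']; split=> [a u v Su Sv|v Sv v0]; last by rewrite n// n'// addr0.
by rewrite l// l'//; ring.
Qed.

Lemma lin_nullZ a L : lin_null L -> lin_null (fun v => a * L v).
Proof.
move=> [l n]; split=> [b u v Su Sv|v Sv v0]; last by rewrite n// mulr0.
by rewrite l//; ring.
Qed.

Lemma lin_nullB L L' : lin_null L -> lin_null L' -> lin_null (fun v => L v - L' v).
Proof.
move=> l /(lin_nullZ (-1)) /(lin_nullD l) [h h0]; split=> [a u v Su Sv|v Sv v0].
  by have := h a u v Su Sv; rewrite !mulN1r.
by have := h0 v Sv v0; rewrite !mulN1r.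
Qed.

(** Reduces both properties to the integrand: linearity pointwise, and vanishing wherever field,
    gradient and pressure vanish. *)
Lemma lin_null_integral (f : state -> 'rV[R]_d -> R) :
  (forall v, S v -> integ leb Om (f v)) ->
  (forall a u v x, f (a *: u + v) x = a * f u x + f v x) ->
  (forall v x, fld v.1 x = 0 -> grad v.1 x = 0 -> v.2 x = 0 -> f v x = 0) ->
  lin_null (fun v => \int[leb]_(x in Om) f v x).
Proof.
move=> fi fl f0; split=> [a u v Su Sv|v Sv v0].
  by apply: Rintegral_lin => //; exact: fi.
apply: ae_Rintegral_eq0 => //; first exact: fi.
by apply: filterS v0 => x vx /vx[]; exact: f0.
Qed.

Lemma fldP a (u v : state) x : fld (a *: u + v).1 x = a *: fld u.1 x + fld v.1 x.
Proof. by []. Qed.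

Lemma gradP a (u v : state) x :
  grad (a *: u + v).1 x = a *: grad u.1 x + grad v.1 x.
Proof. by []. Qed.

Lemma prsP a (u v : state) x : (a *: u + v).2 x = a * u.2 x + v.2 x.
Proof. by []. Qed.

Lemma divP a (u v : state) x : div (a *: u + v).1 x = a * div u.1 x + div v.1 x.
Proof. by rewrite /div gradP mxtraceD mxtraceZ. Qed.

Lemma div0 (v : state) x : grad v.1 x = 0 -> div v.1 x = 0.
Proof. by rewrite /div => ->; rewrite mxtrace0. Qed.

Lemma advectPl a (u v : state) z w x :
  advect (a *: u + v).1 z w x = a * advect u.1 z w x + advect v.1 z w x.
Proof. by rewrite /advect fldP mulmxDl -scalemxAl dotPl. Qed.

Lemma advectPm a (u v : state) z w x :
  advect z (a *: u + v).1 w x = a * advect z u.1 w x + advect z v.1 w x.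
Proof. by rewrite /advect gradP mulmxDr -scalemxAr dotPl. Qed.

Lemma advectPr a (u v : state) z w x :
  advect z w (a *: u + v).1 x = a * advect z w u.1 x + advect z w v.1 x.
Proof. by rewrite /advect fldP dotPr. Qed.

Let advect_integ u z (v : state) : mx_sqint leb Om (fld u) ->
  mx_sqint leb Om (grad z) -> S v -> integ leb Om (advect u z v.1).
Proof. by move=> su sz Sv; apply: dot_mul_integ => //; exact: fld_bd. Qed.

Let div_integ (u v : state) : S u -> S v ->
  integ leb Om (fun x => div u.1 x * v.2 x - div v.1 x * u.2 x).
Proof.
by move=> Su Sv; apply: integB => //; apply: sqintM => //;
  solve [exact: prs_L2 | apply: tr_sqint => //; exact: grad_L2].
Qed.

(** [nuT] is a bounded weight times a square-integrable norm, and [B] bounded keeps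
    [ddot (H x) (B x)] square-integrable, so [H] may contain the gradient of the lift. *)
Let opA3_integ (U : state) (H B : 'rV[R]_d -> 'M[R]_d) : S U ->
  mx_aebd leb Om B -> mx_sqint leb Om H ->
  integ leb Om (fun x => nuT pb (U.1 + uD) x * ddot (H x) (B x)).
Proof.
move=> SU bB sH.
have := integ_aebd mOm (sqintM mOm (fnorm_sqint mOm (gUD_L2 SU))
  (ddot_sqint mOm sH bB)) om_aebd.
by apply: integ_eq => // x _; rewrite nuTE; ring.
Qed.

(** The directional derivative of the Frobenius norm at the full gradient, 0 where that gradient
    vanishes. *)
Definition dgradnorm (U Z : state) x : R :=
  ddot (grad (U.1 + uD) x) (grad Z.1 x) / fnorm (grad (U.1 + uD) x).

Let dA3_integ (U Z V : state) : S U -> S Z -> S V ->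
  integ leb Om (fun x => dgradnorm U Z x * ddot (grad (U.1 + uD) x) (grad V.1 x)).
Proof.
move=> SU SZ SV; apply: sqintM => //.
  by apply: ddot_div_fnorm_sqint => //; [exact: gUD_L2|exact: grad_L2].
by apply: ddot_sqint => //; [exact: gUD_L2|exact: grad_bd].
Qed.

Lemma opdAE mu (U V Z : state) : S U -> S V -> S Z ->
  opdA pb mu U V Z = mu^-1 * opA0 pb Z.1 V.1 + opA1 pb Z V
  + \int[leb]_(x in Om) (advect U.1 Z.1 V.1 x)
  + \int[leb]_(x in Om) (advect Z.1 U.1 V.1 x)
  + \int[leb]_(x in Om)
      (nuT pb (U.1 + uD) x * ddot (grad Z.1 x) (grad V.1 x))
  + \int[leb]_(x in Om)
      (om x * (dgradnorm U Z x * ddot (grad (U.1 + uD) x) (grad V.1 x))).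
Proof.
move=> SU SV SZ; rewrite /opdA; congr (_ + _).
rewrite -Rintegral_KO; last exact: dA3_integ.
apply: eq_bigr => k _; apply: eq_Rintegral => x _.
by rewrite [RHS]mulrA.
Qed.

Lemma opA0_lin_nullr (U : state) : S U -> lin_null (fun V => opA0 pb U.1 V.1).
Proof.
move=> SU; apply: lin_null_integral => [v Sv|a u v x|v x _ v0 _].
- by apply: ddot_integ => //; exact: grad_L2.
- by rewrite gradP ddotPr.
- by rewrite v0 ddot0r.
Qed.

Lemma opA0_lin_nulll (V : state) : S V -> lin_null (fun U => opA0 pb U.1 V.1).
Proof.
move=> SV; apply: lin_null_integral => [v Sv|a u v x|v x _ v0 _].
- by apply: ddot_integ => //; exact: grad_L2.
- by rewrite gradP ddotPl.
- by rewrite v0 ddot0l.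
Qed.

Lemma opA1_lin_nullr (U : state) : S U -> lin_null (opA1 pb U).
Proof.
move=> SU; apply: lin_nullD; first apply: lin_nullD; apply: lin_null_integral.
- by move=> v Sv; exact: div_integ.
- by move=> a u v x; rewrite divP prsP; ring.
- by move=> v x _ v0 p0; rewrite (div0 v0) p0 mulr0 mul0r subr0.
- by move=> v Sv; apply: advect_integ => //; exact: grad_L2.
- by move=> a u v x; rewrite advectPr.
- by move=> v x v0 _ _; rewrite /advect v0 dot0r.
- by move=> v Sv; apply: advect_integ => //; exact: fld_L2.
- by move=> a u v x; rewrite advectPr.
- by move=> v x v0 _ _; rewrite /advect v0 dot0r.
Qed.

Lemma opA1_lin_nulll (V : state) : S V -> lin_null (fun U => opA1 pb U V).
Proof.
move=> SV; apply: lin_nullD; first apply: lin_nullD; apply: lin_null_integral.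
- by move=> v Sv; exact: div_integ.
- by move=> a u v x; rewrite divP prsP; ring.
- by move=> v x _ v0 p0; rewrite (div0 v0) p0 mulr0 mul0r subr0.
- by move=> v Sv; apply: advect_integ => //; exact: grad_L2.
- by move=> a u v x; rewrite advectPm.
- by move=> v x _ v0 _; rewrite /advect v0 mulmx0 dot0l.
- by move=> v Sv; apply: advect_integ => //; exact: fld_L2.
- by move=> a u v x; rewrite advectPl.
- by move=> v x v0 _ _; rewrite /advect v0 mul0mx dot0l.
Qed.

Lemma advect_lin_nullr (U Z : state) : S U -> S Z ->
  lin_null (fun V => \int[leb]_(x in Om) advect U.1 Z.1 V.1 x).
Proof.
move=> SU SZ; apply: lin_null_integral => [v Sv|a u v x|v x v0 _ _].
- by apply: advect_integ => //; [exact: fld_L2|exact: grad_L2].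
- by rewrite advectPr.
- by rewrite /advect v0 dot0r.
Qed.

Lemma opA_lin_null mu (U : state) : S U -> lin_null (opA pb mu U).
Proof.
move=> SU; apply: lin_nullD; first apply: lin_nullD; first apply: lin_nullD.
- by apply: lin_nullZ; exact: opA0_lin_nullr.
- exact: opA1_lin_nullr.
- exact: advect_lin_nullr.
apply: lin_null_integral => [v Sv|a u v x|v x _ v0 _].
- by apply: opA3_integ => //; [exact: grad_bd|exact: gUD_L2].
- by rewrite gradP ddotPr; ring.
- by rewrite v0 ddot0r mulr0.
Qed.

Lemma opF_lin_null mu : lin_null (opF pb mu).
Proof.
apply: lin_nullB; first apply: lin_nullB.
- apply: lin_null_integral => [v Sv|a u v x|v x v0 _ _].
  + by apply: dot_integ => //; exact: fld_L2.
  + by rewrite fldP dotPr.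
  + by rewrite v0 dot0r.
- apply: lin_nullZ; apply: lin_null_integral => [v Sv|a u v x|v x _ v0 _].
  + by apply: ddot_integ => //; exact: grad_L2.
  + by rewrite gradP ddotPr.
  + by rewrite v0 ddot0r.
- apply: lin_null_integral => [v Sv|a u v x|v x v0 _ _].
  + exact: advect_integ.
  + by rewrite advectPr.
  + by rewrite /advect v0 dot0r.
Qed.

Lemma residual_lin_null mu (U : state) : S U -> lin_null (residual pb mu U).
Proof. by move=> SU; apply: lin_nullB; [exact: opA_lin_null|exact: opF_lin_null]. Qed.

Lemma lin_null_ext L L' : (forall v, S v -> L v = L' v) -> lin_null L -> lin_null L'.
Proof.
move=> LL [l n]; split=> [a u v Su Sv|v Sv v0].
  by rewrite -!LL ?l//; apply: SS.2.
by rewrite -LL// n.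
Qed.

Lemma opdA_lin_nullr mu (U Z : state) : S U -> S Z ->
  lin_null (fun V => opdA pb mu U V Z).
Proof.
move=> SU SZ; apply: (lin_null_ext (fun v Sv => esym (opdAE mu SU Sv SZ))).
apply: lin_nullD; first (apply: lin_nullD; first (apply: lin_nullD;
  first (apply: lin_nullD; first apply: lin_nullD))).
- by apply: lin_nullZ; exact: opA0_lin_nullr.
- exact: opA1_lin_nullr.
- exact: advect_lin_nullr.
- exact: advect_lin_nullr.
- apply: lin_null_integral => [v Sv|a u v x|v x _ v0 _].
  + by apply: opA3_integ => //; [exact: grad_bd|exact: grad_L2].
  + by rewrite gradP ddotPr; ring.
  + by rewrite v0 ddot0r mulr0.
apply: lin_null_integral => [v Sv|a u v x|v x _ v0 _].
- have := integ_aebd mOm (dA3_integ SU SZ Sv) om_aebd.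
  by apply: integ_eq => // x _; rewrite mulrC.
- by rewrite gradP ddotPr; ring.
- by rewrite v0 ddot0r !mulr0.
Qed.

Lemma opdA_lin_nulll mu (U V : state) : S U -> S V ->
  lin_null (opdA pb mu U V).
Proof.
move=> SU SV; apply: (lin_null_ext (fun v Sv => esym (opdAE mu SU SV Sv))).
apply: lin_nullD; first (apply: lin_nullD; first (apply: lin_nullD;
  first (apply: lin_nullD; first apply: lin_nullD))).
- by apply: lin_nullZ; exact: opA0_lin_nulll.
- exact: opA1_lin_nulll.
- apply: lin_null_integral => [v Sv|a u v x|v x _ v0 _].
  + by apply: advect_integ => //; [exact: fld_L2|exact: grad_L2].
  + by rewrite advectPm.
  + by rewrite /advect v0 mulmx0 dot0l.
- apply: lin_null_integral => [v Sv|a u v x|v x v0 _ _].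
  + by apply: advect_integ => //; [exact: fld_L2|exact: grad_L2].
  + by rewrite advectPl.
  + by rewrite /advect v0 mul0mx dot0l.
- apply: lin_null_integral => [v Sv|a u v x|v x _ v0 _].
  + by apply: opA3_integ => //; [exact: grad_bd|exact: grad_L2].
  + by rewrite gradP ddotPl; ring.
  + by rewrite v0 ddot0l mulr0.
apply: lin_null_integral => [v Sv|a u v x|v x _ v0 _].
- have := integ_aebd mOm (dA3_integ SU Sv SV) om_aebd.
  by apply: integ_eq => // x _; rewrite mulrC.
- by rewrite /dgradnorm gradP ddotPr; ring.
- by rewrite /dgradnorm v0 ddot0r mul0r mul0r mulr0.
Qed.


(** * Quadratic remainder and mean value theorem for the operator *)

Lemma gradUD s (W U : state) x : grad ((s *: W + U).1 + uD) x =
  grad (U.1 + uD) x + s *: grad W.1 x.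
Proof.
by rewrite [LHS](_ : _ = s *: grad W.1 x + grad U.1 x + grad uD x)// -addrA addrC.
Qed.

Lemma opA2_expansion s (U W V : state) : S U -> S W -> S V ->
  opA2 pb (s *: W + U) V = opA2 pb U V
  + s * (\int[leb]_(x in Om) advect U.1 W.1 V.1 x
         + \int[leb]_(x in Om) advect W.1 U.1 V.1 x)
  + s ^+ 2 * \int[leb]_(x in Om) advect W.1 W.1 V.1 x.
Proof.
move=> SU SW SV.
have ai (Y Z : state) : S Y -> S Z -> integ leb Om (advect Y.1 Z.1 V.1).
  by move=> SY SZ; apply: advect_integ => //; [exact: fld_L2|exact: grad_L2].
have i1 := integD mOm (ai _ _ SU SW) (ai _ _ SW SU).
have i2 := integD mOm i1 (integZ mOm s (ai _ _ SW SW)).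
rewrite /opA2 (@Rintegral_lin _ _ _ _ _ mOm s _ _ _ i2 (ai _ _ SU SU)).
  rewrite RintegralD//; last exact/integZ/ai.
  rewrite RintegralZl//; last exact: ai.
  by rewrite RintegralD//; [ring|exact: ai..].
by move=> x _; rewrite advectPl !advectPm; ring.
Qed.

(** The pointwise remainder of [|G| G] is integrated. Its bound contains only the gradients of [W]
    and [V], not the one involving the lift, so it is integrable, and its integral is a constant
    uniform in [s]. *)
Lemma opA3_quadratic (U W V : state) : S U -> S W -> S V ->
  exists C, forall s, `|opA3 pb (s *: W + U) V - opA3 pb U V
    - s * (\int[leb]_(x in Om)
              (nuT pb (U.1 + uD) x * ddot (grad W.1 x) (grad V.1 x))
           + \int[leb]_(x in Om)
              (om x * (dgradnorm U W x * ddot (grad (U.1 + uD) x) (grad V.1 x))))|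
    <= C * s ^+ 2.
Proof.
move=> SU SW SV.
pose B x := om x * (3 / 2 * (ddot (grad W.1 x) (grad W.1 x) * fnorm (grad V.1 x))).
have iB : integ leb Om B.
  have := integ_aebd mOm (integZ mOm (3 / 2) (sqintM mOm
    (ddot_sqint mOm (grad_L2 SW) (grad_bd SW)) (fnorm_sqint mOm (grad_L2 SV)))) om_aebd.
  by apply: integ_eq => // x _; rewrite mulrC.
exists (\int[leb]_(x in Om) B x) => s.
have SX : S (s *: W + U) by exact: SS.2.
have i3 (Y : state) : S Y -> integ leb Om (fun x => nuT pb (Y.1 + uD) x *
    ddot (grad (Y.1 + uD) x) (grad V.1 x)).
  by move=> SY; apply: opA3_integ => //; [exact: grad_bd|exact: gUD_L2].
have i1 : integ leb Om (fun x => nuT pb (U.1 + uD) x * ddot (grad W.1 x) (grad V.1 x)).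
  by apply: opA3_integ => //; [exact: grad_bd|exact: grad_L2].
have i2 : integ leb Om (fun x => om x *
    (dgradnorm U W x * ddot (grad (U.1 + uD) x) (grad V.1 x))).
  have := integ_aebd mOm (dA3_integ SU SW SV) om_aebd.
  by apply: integ_eq => // x _; rewrite mulrC.
have i12 := integD mOm i1 i2.
have i0 := integB mOm (i3 _ SX) (i3 _ SU).
rewrite /opA3 -RintegralD// -RintegralB//; [|exact: i3..].
rewrite -RintegralZl// -RintegralB//; last exact: integZ.
rewrite mulrC -RintegralZl//.
apply: norm_Rintegral_le => //.
- by apply: integB => //; exact: integZ.
- exact: integZ.
move=> x _; rewrite !nuTE gradUD /B /dgradnorm.
set G := grad (U.1 + uD) x; set H := grad W.1 x; set N := grad V.1 x.
rewrite [leRHS]mulrCA -[om x in leRHS](ger0_norm (om_ge0 x)).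
have := ler_wpM2l (normr_ge0 (om x)) (fnorm_mul_expansion s G H N).
rewrite -normrM; apply: le_trans.
by rewrite le_eqVlt; apply/orP; left; apply/eqP; congr `| _ |; ring.
Qed.

(** [opA0] and [opA1] are linear in the first argument and leave no remainder; convection leaves
    exactly [s ^+ 2 * a2]. *)
Lemma opA_quadratic mu (U W V : state) : S U -> S W -> S V ->
  exists C, forall s, `|opA pb mu (s *: W + U) V - opA pb mu U V
    - s * opdA pb mu U V W| <= C * s ^+ 2.
Proof.
move=> SU SW SV; have [C HC] := opA3_quadratic SU SW SV.
set a2 := \int[leb]_(x in Om) advect W.1 W.1 V.1 x.
exists (`|a2| + C) => s; rewrite opdAE// /opA opA2_expansion//.
rewrite (opA0_lin_nulll SV).1// (opA1_lin_nulll SV).1//.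
have := HC s; set r := (X in `|X|) => Hr.
rewrite mulrDl [X in `|X| <= _](_ : _ = s ^+ 2 * a2 + r); last first.
  by rewrite /r /a2; ring.
apply: le_trans (ler_normD _ _) (lerD _ Hr).
by rewrite normrM (ger0_norm (sqr_ge0 s)) mulrC.
Qed.

(** Expanding at [X t] with increment [s] gives the derivative of the scalar function [phi] at every
    [t], so the one-dimensional theorem applies. *)
Lemma opA_mean_value mu (U1 U2 V : state) : S U1 -> S U2 -> S V ->
  exists2 t, 0 <= t <= 1 & opA pb mu U2 V - opA pb mu U1 V =
    opdA pb mu (U1 + t *: (U2 - U1)) V (U2 - U1).
Proof.
move=> S1 S2 SV; have SW : S (U2 - U1) by exact: subspaceB.
pose X t := U1 + t *: (U2 - U1).
have SX t : S (X t) by apply: subspaceD => //; exact: subspaceZ.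
pose phi : R -> R := fun t => opA pb mu (X t) V.
pose dphi : R -> R := fun t => opdA pb mu (X t) V (U2 - U1).
have phiP (t : R) : is_derive t 1 phi (dphi t).
  have [C HC] := opA_quadratic mu (SX t) SW SV.
  apply: (is_derive_quadratic (C := C)) => s; rewrite /phi.
  rewrite (_ : X (t + s) = s *: (U2 - U1) + X t) ?HC//.
  by rewrite /X scalerDl [t *: _ + _]addrC addrCA.
have [|t] := @MVT R phi dphi 0 1 ltr01 (fun t _ => phiP t).
  by apply: derivable_within_continuous => t _; exact: ex_derive.
rewrite in_itv/= => /andP[t0 t1].
rewrite /phi /dphi /X scale1r scale0r addr0 subr0 mulr1 [U1 + (U2 - U1)]addrC subrK => E.
by exists t; [rewrite !ltW|].
Qed.

(** * The norm of the discrete space and its null states *)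

Section norm.
Context (kap : 'rV[R]_d -> R).
Hypothesis kap_ge0 : forall x, 0 <= kap x.
Hypothesis SY : forall U, S U -> inY pb U.1.
Hypothesis hequiv : T_norm_equiv_H1 pb kap.

Let energy_integ (U : state) : S U ->
  integ leb Om (fun x => kap x * ddot (grad U.1 x) (grad U.1 x)).
Proof. by move=> SU; case: hequiv => c [C [_ _ /(_ _ (SY SU))[]]]. Qed.

(** Polarization: [hequiv] provides integrability of the energy of a single field only, and the
    weight [kap] is not known to be bounded. *)
Let ipT_integ (U V : state) : S U -> S V ->
  integ leb Om (fun x => kap x * ddot (grad U.1 x) (grad V.1 x)).
Proof.
move=> SU SV; have SUV : S (1 *: U + V) by exact: SS.2.
have := integZ mOm 2^-1 (integB mOm (integB mOm (energy_integ SUV)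
  (energy_integ SU)) (energy_integ SV)).
apply: integ_eq => // x _; rewrite gradP ddotPl !ddotPr (ddotC (grad V.1 x)).
by field.
Qed.

Definition ipX (U V : state) : R :=
  ipT pb kap U.1 V.1 + \int[leb]_(x in Om) (U.2 x * V.2 x).

Lemma ipX_lin (V : state) : S V -> lin_null (fun U => ipX U V).
Proof.
move=> SV; apply: lin_nullD; apply: lin_null_integral.
- by move=> v Sv; exact: ipT_integ.
- by move=> a u v x; rewrite gradP ddotPl; ring.
- by move=> v x _ v0 _; rewrite v0 ddot0l mulr0.
- by move=> v Sv; apply: sqintM => //; exact: prs_L2.
- by move=> a u v x; rewrite prsP; ring.
- by move=> v x _ _ ->; rewrite mul0r.
Qed.

Lemma ipX_sym U V : ipX U V = ipX V U.
Proof.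
by congr (_ + _); apply: eq_Rintegral => x _; [rewrite ddotC|rewrite mulrC].
Qed.

Let ipT_ge0 (u : vfield R d) : 0 <= ipT pb kap u u.
Proof. by apply: Rintegral_ge0 => x _; rewrite mulr_ge0 ?kap_ge0 ?ddot_ge0. Qed.

Let prs_ge0 (p : 'rV[R]_d -> R) : 0 <= \int[leb]_(x in Om) (p x ^+ 2).
Proof. by apply: Rintegral_ge0 => x _; exact: sqr_ge0. Qed.

Lemma normXE U : normX pb kap U = Num.sqrt (ipX U U).
Proof.
rewrite /normX /normT /normL2 !sqr_sqrtr//; congr (Num.sqrt (_ + _)).
Qed.

Lemma ipX_ge0 U : 0 <= ipX U U.
Proof. by apply: addr_ge0; [exact: ipT_ge0|exact: prs_ge0]. Qed.

Lemma normX_seminorm : seminorm_on S (normX pb kap).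
Proof.
rewrite (_ : normX pb kap = fun U => Num.sqrt (ipX U U)); last first.
  by apply/funext => U; exact: normXE.
apply: (psd_seminorm SS) => [V SV||]; [exact: (ipX_lin SV).1|exact: ipX_sym|].
exact: ipX_ge0.
Qed.

(** [ipT] sees gradients only; the lower bound in the equivalence with the H^1 norm is what makes
    the field itself vanish. *)
Lemma normX_eq0 U : S U -> normX pb kap U = 0 <-> ae_eq_state Om U 0.
Proof.
move=> SU; split; last by move=> U0; rewrite normXE (ipX_lin SU).2// sqrtr0.
rewrite normXE => /eqP; rewrite sqrtr_eq0 => ipX_le0.
have ip0 : ipX U U = 0 by apply/eqP; rewrite eq_le ipX_le0 ipX_ge0.
move: ip0 => /eqP; rewrite paddr_eq0 ?ipT_ge0//; last exact: prs_ge0.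
move=> /andP[/eqP T0 /eqP p0].
have [c [C [c0 _ /(_ _ (SY SU))[_ /andP[cT _]]]]] := hequiv.
have i1 : integ leb Om (fun x => dot (fld U.1 x) (fld U.1 x)).
  by apply: dot_integ => //; exact: fld_L2.
have i2 : integ leb Om (fun x => ddot (grad U.1 x) (grad U.1 x)).
  by apply: ddot_integ => //; exact: grad_L2.
have I1 : 0 <= \int[leb]_(x in Om) dot (fld U.1 x) (fld U.1 x).
  by apply: Rintegral_ge0 => x _; exact: dot_ge0.
have I2 : 0 <= \int[leb]_(x in Om) ddot (grad U.1 x) (grad U.1 x).
  by apply: Rintegral_ge0 => x _; exact: ddot_ge0.
move: cT; rewrite /normT T0 sqrtr0 pmulr_rle0// /normH1 => H1.
have : normH1 pb.(Omega) U.1 == 0 by rewrite eq_le H1 sqrtr_ge0.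
rewrite sqrtr_eq0 => sum0.
have : \int[leb]_(x in Om) dot (fld U.1 x) (fld U.1 x) +
  \int[leb]_(x in Om) ddot (grad U.1 x) (grad U.1 x) == 0.
  by rewrite eq_le sum0 addr_ge0.
rewrite paddr_eq0// => /andP[/eqP f0 /eqP g0].
have := Rintegral_eq0_ae mOm i1 (fun x => dot_ge0 _) f0.
have := Rintegral_eq0_ae mOm i2 (fun x => ddot_ge0 _) g0.
have := Rintegral_eq0_ae mOm (sqintM mOm (prs_L2 SU) (prs_L2 SU))
  (fun x => sqr_ge0 _) p0.
apply: filterS3 => x px gx fx Ox; split.
- by apply: dot_eq0; exact: fx.
- by apply: ddot_eq0; exact: gx.
- by apply/eqP; rewrite -sqrf_eq0 expr2 px.
Qed.

End norm.

End operators.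

(** * Spans and products of finite-dimensional spaces *)

Section linear_spans.
Context (R : realType).

Lemma span_subspace (V : lmodType R) (I : finType) (b : I -> V) :
  subspace_set (Defs.span b).
Proof.
split=> [|a _ _ [c ->] [c' ->]].
  by exists (fun=> 0); rewrite big1// => i _; rewrite scale0r.
exists (fun i => a * c i + c' i); rewrite scaler_sumr -big_split/=.
by apply: eq_bigr => i _; rewrite scalerDl scalerA.
Qed.

Lemma fin_dim_subspace (V : lmodType R) (S : set V) : fin_dim S -> subspace_set S.
Proof. by move=> [n [b ->]]; exact: span_subspace. Qed.

Lemma span_sub (V : lmodType R) (S : set V) (I : finType) (b : I -> V) :
  subspace_set S -> (forall i, S (b i)) -> Defs.span b `<=` S.
Proof.
move=> SS bS _ [c ->]; apply: (big_ind S) => [|u v|i _].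
- exact: subspace0.
- exact: subspaceD.
- exact: subspaceZ.
Qed.

Lemma fin_dim_setX (V W : lmodType R) (A : set V) (B : set W) :
  fin_dim A -> fin_dim B -> fin_dim (A `*` B).
Proof.
move=> [n [a ->]] [m [b ->]].
pose g (i : 'I_(n + m)) : V * W :=
  match fintype.split i with inl j => (a j, 0) | inr k => (0, b k) end.
exists (n + m)%N, g.
have gl j : g (lshift m j) = (a j, 0) by rewrite /g (unsplitK (inl _)).
have gr k : g (rshift n k) = (0, b k) by rewrite /g (unsplitK (inr _)).
have sumE (c : 'I_(n + m) -> R) : \sum_i c i *: g i =
    (\sum_j c (lshift m j) *: a j, \sum_k c (rshift n k) *: b k).
  rewrite big_split_ord/=.
  under eq_bigr do rewrite gl.
  under [X in _ + X]eq_bigr do rewrite gr.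
  apply: injective_projections; rewrite /= !raddf_sum/=.
    by rewrite [X in _ + X]big1 ?addr0// => k _; rewrite scaler0.
  by rewrite [X in X + _]big1 ?add0r// => k _; rewrite scaler0.
apply/seteqP; split => [[u v] [/= [c ->] [e ->]]|_ [c ->]].
  exists (fun i => match fintype.split i with inl j => c j | inr k => e k end).
  rewrite sumE; congr (_, _); apply: eq_bigr => i _.
    by rewrite (unsplitK (inl _)).
  by rewrite (unsplitK (inr _)).
rewrite sumE; split.
  by exists (fun j => c (lshift m j)).
by exists (fun k => c (rshift n k)).
Qed.

End linear_spans.

(** * Transfer of the abstract estimates to the reduced basis problem *)

Theorem theorem2 (R : realType) (d : nat) (hd : d = 2%N \/ d = 3%N)
    (pb : problem R d)
    (hOmega : polyhedral_domain (Omega pb))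
    (hGamma : GammaD pb `|` GammaN pb = boundary (Omega pb))
    (hmesh : conforming_mesh (Omega pb) (mesh pb))
    (hCS : 0 < CS pb)
    (hforce : forall j, L2 (Omega pb) (fun x => force pb x 0 j))
    (huD : dirichlet_divfree pb (uD pb))
    (* parameter interval *)
    (mu_min mu_max : R) (hmin : 0 < mu_min) (hmax : mu_min <= mu_max)
    (D : set R) (hD : D = [set mu | mu_min <= mu <= mu_max])
    (* reference weight 1 / mubar + nu_T^* *)
    (w : R -> vfield R d) (hw : forall mu, D mu -> velocity_solution pb mu (w mu))
    (mubar : R) (hmubar : is_argmin pb D w mubar)
    (kap : 'rV[R]_d -> R)
    (hkap : kap = (fun x => mubar^-1 + nuT pb (w mubar) x))
    (hequiv : T_norm_equiv_H1 pb kap)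
    (* finite element spaces *)
    (Yh : set (vfield R d)) (hYh : fe_velocity_space pb Yh)
    (Mh : set ('rV[R]_d -> R)) (hMh : fe_pressure_space pb Mh)
    (Xh : set (state R d)) (hXh : Xh = Yh `*` Mh)
    (* Lipschitz constant *)
    (rhoT : R) (hrhoT : 0 < rhoT)
    (hLip : forall U1 U2 Z V, Xh U1 -> Xh U2 -> Xh Z -> Xh V ->
      forall mu, D mu ->
      `|opdA pb mu U1 V Z - opdA pb mu U2 V Z|
        <= rhoT * normX pb kap (U1 - U2) * normX pb kap Z * normX pb kap V)
    (* reduced basis problem *)
    (N : nat) (hN : (0 < N)%N) (mus : 'I_N -> R) (hmus : forall k, D (mus k))
    (snap : 'I_N -> state R d) (hsnap : forall k, solves pb (mus k) Xh (snap k))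
    (Tp : ('rV[R]_d -> R) -> vfield R d) (hTp : is_supremizer pb kap Yh Mh Tp)
    (UN : R -> state R d)
    (hUN : forall mu, D mu -> solves pb mu (rb_space Tp snap) (UN mu))
    (* assumptions of the theorem *)
    (hbt : forall mu, D mu ->
      0 < betaN pb kap Xh mu (UN mu) /\ tauN pb kap Xh rhoT mu (UN mu) <= 1) :
  forall mu, D mu ->
    exists Uh : state R d,
      [/\ solves pb mu Xh Uh
            /\ normX pb kap (Uh - UN mu) <= DeltaN pb kap Xh rhoT mu (UN mu),
          forall Uh' : state R d,
            solves pb mu Xh Uh'
              /\ normX pb kap (Uh' - UN mu) <= DeltaN pb kap Xh rhoT mu (UN mu) ->
            ae_eq_state (Omega pb) Uh' Uh
        & DeltaN pb kap Xh rhoT mu (UN mu)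
            <= (2 * gammaN pb kap Xh mu (UN mu) / betaN pb kap Xh mu (UN mu)
                + tauN pb kap Xh rhoT mu (UN mu))
               * normX pb kap (Uh - UN mu)].
Proof.
move=> mu Dmu.
have [[oOm _ _ bOm] _] := hOmega.
have [_ cells _ _] := hmesh.
have [uD_H1 _ _ _] := huD.
have [fYh YhY] := hYh; have [fMh MhM] := hMh.
have fXh : fin_dim Xh by rewrite hXh; exact: fin_dim_setX.
have SS := fin_dim_subspace fXh.
have bXh U : Xh U -> bounded_state pb U.
  rewrite hXh => -[/YhY[[uH1 _] uP] /MhM[pL2 pP]].
  exact: fe_bounded_state.
have XhY U : Xh U -> inY pb U.1 by rewrite hXh => -[/YhY[]].
have kap_ge0 x : 0 <= kap x.
  have mubar_gt0 : 0 < mubar.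
    by have [] := hmubar; rewrite hD => /andP[h _] _; exact: lt_le_trans h.
  by rewrite hkap addr_ge0 ?invr_ge0 ?(ltW mubar_gt0)// nuTE mulr_ge0 ?om_ge0 ?fnorm_ge0.
have sX := normX_seminorm oOm bOm SS bXh kap_ge0 XhY hequiv.
have X0 U (XU : Xh U) := normX_eq0 oOm bOm SS bXh kap_ge0 XhY hequiv XU.
(* The reduced space lies in [Xh]: its generators are components of finite element solutions, or
   supremizers, which [hTp] places in [Yh]. *)
have XUN : Xh (UN mu).
  have [[Y M] _] := hUN _ Dmu.
  have Ysnap k : Yh (snap k).1 by have := (hsnap k).1; rewrite hXh => -[].
  have Msnap k : Mh (snap k).2 by have := (hsnap k).1; rewrite hXh => -[].
  rewrite hXh; split.
    apply: span_sub Y; first exact: fin_dim_subspace.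
    by case=> k //; exact: (hTp _ (Msnap k)).1.
  by apply: span_sub M => //; exact: fin_dim_subspace.
(* Both descriptions of the admissible states agree, so [betaN], [gammaN], [tauN] and [DeltaN] are
   the abstract constants. *)
have nzE : nonzero pb Xh = nonnull Xh (normX pb kap).
  by apply/seteqP; split => U [XU nU]; split => // /(X0 _ XU).
have res_ln U (XU : Xh U) := residual_lin_null oOm bOm uD_H1 hforce bXh mu XU.
have dA_lnr Z (XZ : Xh Z) := opdA_lin_nullr oOm bOm uD_H1 SS bXh mu XUN XZ.
have dA_lnl V (XV : Xh V) := opdA_lin_nulll oOm bOm uD_H1 SS bXh mu XUN XV.
have res_lin U (XU : Xh U) := (res_ln U XU).1.
have res_null U V (XU : Xh U) (XV : Xh V) : normX pb kap V = 0 -> residual pb mu U V = 0.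
  by move=> /(X0 _ XV); exact: (res_ln U XU).2.
have dA_nulll V Z (XV : Xh V) (XZ : Xh Z) :
    normX pb kap V = 0 -> opdA pb mu (UN mu) V Z = 0.
  by move=> /(X0 _ XV); exact: (dA_lnr Z XZ).2.
have dA_nullr V Z (XV : Xh V) (XZ : Xh Z) :
    normX pb kap Z = 0 -> opdA pb mu (UN mu) V Z = 0.
  by move=> /(X0 _ XZ); exact: (dA_lnl V XV).2.
have mv U1 U2 V : Xh U1 -> Xh U2 -> Xh V -> exists2 t, 0 <= t <= 1 &
    residual pb mu U2 V - residual pb mu U1 V =
    opdA pb mu (U1 + t *: (U2 - U1)) V (U2 - U1).
  move=> X1 X2 XV.
  have [t t01 E] := opA_mean_value oOm bOm uD_H1 SS bXh mu X1 X2 XV.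
  by exists t => //; rewrite -E /residual; ring.
have lip U Z V (XU : Xh U) (XZ : Xh Z) (XV : Xh V) :=
  hLip U (UN mu) Z V XU XUN XZ XV mu Dmu.
have betaE : betaN pb kap Xh mu (UN mu) =
    infsup Xh (normX pb kap) (opdA pb mu) (UN mu) by rewrite /betaN nzE.
have gammaE : gammaN pb kap Xh mu (UN mu) =
    supsup Xh (normX pb kap) (opdA pb mu) (UN mu) by rewrite /gammaN nzE.
have tauE : tauN pb kap Xh rhoT mu (UN mu) =
    tau Xh (normX pb kap) (residual pb mu) (opdA pb mu) (UN mu) rhoT.
  by rewrite /tauN betaE /epsilonN /dual_norm nzE.
have DeltaE : DeltaN pb kap Xh rhoT mu (UN mu) =
    error_radius Xh (normX pb kap) (residual pb mu) (opdA pb mu) (UN mu) rhoT.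
  by rewrite /DeltaN tauE betaE.
have [beta0 tau1] := hbt _ Dmu.
rewrite DeltaE tauE gammaE betaE; rewrite betaE in beta0; rewrite tauE in tau1.
have solE U : solves pb mu Xh U <->
    Xh U /\ forall V, Xh V -> residual pb mu U V = 0.
  by split=> -[XU UE]; split=> // V XV; apply/eqP; have /eqP := UE V XV;
    rewrite /residual subr_eq0.
have [Uh [XUh rUh resUh]] := solution_exists SS fXh sX XUN hrhoT res_lin res_null
  (fun Z XZ => (dA_lnr Z XZ).1) (fun V XV => (dA_lnl V XV).1)
  dA_nulll dA_nullr mv lip beta0 tau1.
exists Uh; split; first by split => //; exact/solE.
- move=> U' [/solE[XU' resU'] rU'].
  have := solution_unique SS fXh sX XUN hrhoT res_lin res_null
    (fun Z XZ => (dA_lnr Z XZ).1) (fun V XV => (dA_lnl V XV).1)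
    dA_nulll dA_nullr mv lip beta0 XUh XU' rUh rU' resUh resU'.
  (* A difference of zero norm is an a.e. null state, which is uniqueness in the sense of
     [ae_eq_state]. *)
  move=> /(X0 _ (subspaceB SS XU' XUh)).
  apply: filterS => x + Ox => /(_ Ox)[e1 e2 e3].
  by split; apply/eqP; rewrite -subr_eq0; apply/eqP; [exact: e1|exact: e2|exact: e3].
- exact: (effectivity SS fXh sX XUN hrhoT res_lin res_null
    (fun Z XZ => (dA_lnr Z XZ).1) (fun V XV => (dA_lnl V XV).1)
    dA_nulll dA_nullr mv lip beta0 tau1 XUh rUh resUh).
Qed.
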